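(* Let $n\geq 2$ be an integer, $G=SL(n,\mathbf{Z})$, and let $S=S^{-1}\subset G$ be a finite symmetric generating set of $G$. Let $(X_k)_{k\geq 0}$ be the simple left-invariant random walk on $G$: $X_0=1$ and $X_{k+1}=X_k\xi_{k+1}$ for $k\geq 0$, where $(\xi_k)_{k\geq 1}$ is a sequence of independent $S$-valued random variables with $\mathbf{P}(\xi_k=s)=1/|S|$ for all $s\in S$. Then, almost surely, there are only finitely many $k$ for which the characteristic polynomial $\det(X_k-T)\in\mathbf{Z}[T]$ is reducible. *)

(* Defs.v *)
From HB Require Import structures.
From mathcomp Require Import all_boot all_order all_algebra.
From mathcomp Require Import all_classical all_reals all_analysis.

Set Implicit Arguments.
Unset Strict Implicit.
Unset Printing Implicit Defensive.

Import Order.TTheory GRing.Theory Num.Theory.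
Local Open Scope ring_scope.
Local Open Scope classical_set_scope.

(* S generates SL(n,Z) as a monoid: every integer matrix of determinant 1 is a
   finite product of elements of S (for symmetric S this is group generation). *)
Definition generates_SL (n : nat) (S : seq 'M[int]_n) : Prop :=
  forall g : 'M[int]_n, \det g = 1 ->
    exists w : seq 'M[int]_n, all (fun s => s \in S) w /\
      g = foldr (fun a b => a *m b) 1%:M w.

Definition charpoly_det (n : nat) (X : 'M[int]_n) : {poly int} :=
  \det (map_mx polyC X - 'X%:M).

Definition reducible_poly (p : {poly int}) : Prop :=
  p != 0 /\ p \isn't a GRing.unit /\
  exists q r : {poly int},
    q \isn't a GRing.unit /\ r \isn't a GRing.unit /\ p = q * r.

(* The random walk: X_0 = 1, X_{k+1} = X_k * xi_{k+1}.  Here the increment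
   xi_{k+1} of the paper is xi k (0-based indexing of increments). *)
Definition walk (n : nat) (T : Type) (xi : nat -> T -> 'M[int]_n)
    (k : nat) (w : T) : 'M[int]_n :=
  foldl (fun M i => M *m xi i w) 1%:M (iota 0 k).

Definition mutually_independent d (Omega : measurableType d) (R : realType)
    (P : probability Omega R) (V : Type) (X : nat -> Omega -> V) : Prop :=
  forall (I : seq nat) (B : nat -> set V), uniq I ->
    P (\big[setI/setT]_(i <- I) (X i @^-1` B i)) =
    (\prod_(i <- I) P (X i @^-1` B i))%E.

(* Main.v *)
Require Import Defs.
From HB Require Import structures.
From mathcomp Require Import all_boot all_order all_algebra all_field.
From mathcomp Require Import all_classical all_reals all_analysis.
From mathcomp Require Import ring lra zify.

Set Implicit Arguments.
Unset Strict Implicit.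
Unset Printing Implicit Defensive.

Import Order.TTheory GRing.Theory Num.Theory.
Local Open Scope ring_scope.

(** If the characteristic polynomial of [X] in SL(n,Z) is reducible, a factor of degree
    [0 < d < n] has constant term [+-1], so a product of [d] eigenvalues is [+-1] and
    [det (X^(tensor d) -+ 1) = 0].  The walk therefore only has to avoid finitely many
    proper subvarieties [f = 0] with summable probability, and no equidistribution in finite
    quotients is needed.

    The function [f] is a matrix coefficient of a polynomial representation [rho], so
    that [f (X_k) = 0] reads [v rho(X_k) \in L] for a subspace [L].  Conditioning on the last
    [N] steps, two independent continuations [B], [B'] force [v rho(X_(k-N))] into the
    intersection of [L rho(B)^-1] and [L rho(B')^-1], which has smaller dimension unless the
    two translates coincide.  By induction on [dim L] everything reduces to showing that
    coincidences have exponentially small probability when [L] is not invariant.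

    Through Pluecker coordinates this is a spectral gap for the action of SL(n,Z) on the
    lines of a polynomial representation that consist of non-fixed vectors.  If there were no
    gap, some [f] in [l^2] of the lines would be almost invariant under every
    [U_ij = rho(1 + 2 E_ij)].  But [t |-> x U_ij^t] is polynomial in [t], so an orbit of
    [U_ij] spends only boundedly many times [t] far from the vectors fixed by [U_ij]
    (a polynomial has [|p(t+1) - p(t)| >= c |p(t)|] only near its complex roots).  Hence [f] is
    concentrated near the common fixed vectors of all [U_ij]; modulo those vectors this is
    impossible, because the abelianization of SL(n,Z) is finite. *)

(** * Tensor powers and Pluecker coordinates *)

Local Notation ndim l a := #|{ffun 'I_l -> 'I_a}|.

Section Tensor.
Variables (F : comNzRingType) (l : nat).

Definition fval a (i : 'I_(ndim l a)) : {ffun 'I_l -> 'I_a} :=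
  enum_val i.

(** The [l]-th tensor power of [A], in the basis of pure tensors indexed by functions. *)
Definition tens a b (A : 'M[F]_(a, b)) :
    'M[F]_(ndim l a, ndim l b) :=
  \matrix_(i, j) \prod_k A (fval i k) (fval j k).

(** Pluecker coordinates of the row space. The minors are indexed by all functions, not only the
    increasing ones, so that the tensor power itself acts on them and exterior powers are
    avoided. *)
Definition plu a (A : 'M[F]_(l, a)) : 'rV[F]_(ndim l a) :=
  \row_j \det (colsub (fval j) A).

Lemma sum_enum_val (T : finType) (G : T -> F) :
  \sum_(i < #|T|) G (enum_val i) = \sum_x G x.
Proof.
rewrite [RHS](reindex_onto enum_val enum_rank) => [|x _]; last by rewrite enum_rankK.
by apply: eq_bigl => i; rewrite enum_valK eqxx.
Qed.

Lemma tensM a b c (A : 'M[F]_(a, b)) (B : 'M[_]_(b, c)) :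
  tens (A *m B) = tens A *m tens B.
Proof.
apply/matrixP=> i j; rewrite !mxE.
under eq_bigr do rewrite mxE.
rewrite bigA_distr_bigA /=.
under [RHS]eq_bigr do rewrite !mxE -big_split /=.
by rewrite (sum_enum_val (fun x : {ffun _ -> _} => \prod_k (A (fval i k) (x k) * B (x k) (fval j k)))).
Qed.

Lemma tens1 a : tens (1%:M : 'M[F]_a) = 1%:M.
Proof.
apply/matrixP=> i j; rewrite !mxE.
have [->|ne] := eqVneq i j.
  by rewrite big1 // => k _; rewrite mxE eqxx.
have [k nek|e] := pickP (fun k => fval i k != fval j k).
  by rewrite (bigD1 k) //= mxE (negbTE nek) mul0r.
case/eqP: ne; apply/enum_val_inj/ffunP=> k; apply/eqP; exact: negbFE (e k).
Qed.

(** A redundant form of Cauchy-Binet. In the transposed Leibniz formula the permutation moves only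
    the row index of [A], so after distributing the product over functions [K], the factors of [B]
    come out of the sum over permutations. *)
Lemma pluM a b (A : 'M[F]_(l, a)) (B : 'M[_]_(a, b)) :
  plu (A *m B) = plu A *m tens B.
Proof.
apply/rowP=> j; rewrite !mxE -det_tr.
rewrite {1}/determinant.
under eq_bigr => s _.
  under eq_bigr do rewrite !mxE.
  rewrite bigA_distr_bigA /= mulr_sumr.
  over.
rewrite exchange_big /=.
under [RHS]eq_bigr do rewrite !mxE.
rewrite (sum_enum_val (fun x : {ffun _ -> _} => \det (colsub x A) * \prod_k B (x k) (fval j k))).
apply: eq_bigr => K _; rewrite -det_tr /determinant mulr_suml.
apply: eq_bigr => s _; rewrite big_split /= mulrA; congr (_ * _ * _).
by apply: eq_bigr => i _; rewrite !mxE.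
Qed.

Lemma plu_mull a (C : 'M[F]_l) (A : 'M[F]_(l, a)) :
  plu (C *m A) = \det C *: plu A.
Proof.
apply/rowP=> j; rewrite !mxE -det_mulmx; congr (\det _).
by apply/matrixP=> i k; rewrite !mxE; apply: eq_bigr => s _; rewrite !mxE.
Qed.

Lemma plu_det (A : 'M[F]_l) :
  plu A 0 (enum_rank [ffun i => i]) = \det A.
Proof.
by rewrite mxE /fval enum_rankK; congr (\det _); apply/matrixP=> i j; rewrite !mxE ffunE.
Qed.

End Tensor.

Lemma tens_map (F G : comNzRingType) (f : {rmorphism F -> G}) l a b (A : 'M[F]_(a, b)) :
  tens l (map_mx f A) = map_mx f (tens l A).
Proof. by apply/matrixP=> i j; rewrite !mxE rmorph_prod; apply: eq_bigr => k _; rewrite mxE. Qed.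

Section PluField.
Variables (F : fieldType) (l a : nat).
Implicit Types A B : 'M[F]_(l, a).

Lemma plu_neq0 A : row_free A -> plu A != 0.
Proof.
move=> /row_freeP [B AB1]; apply/eqP=> A0.
have := pluM A B; rewrite AB1 A0 mul0mx => /rowP /(_ (enum_rank [ffun i => i])).
by rewrite plu_det det1 mxE => /eqP; rewrite oner_eq0.
Qed.

(** When the columns [J] form the identity, the entry at [(i, c)] is itself a minor: the one in
    which column [J i] is replaced by column [c]. *)
Lemma plu_eq1 (J : 'I_l -> 'I_a) A B :
  colsub J A = 1%:M -> colsub J B = 1%:M -> plu A = plu B -> A = B.
Proof.
have key M i c : colsub J M = 1%:M :> 'M[F]_l ->
    plu M 0 (enum_rank [ffun k => if k == i then c else J k]) = M i c.
  move=> M1; rewrite mxE /fval enum_rankK (expand_det_col _ i).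
  have cf r : cofactor (colsub [ffun k => if k == i then c else J k] M) r i = (r == i)%:R.
    have -> : cofactor (colsub [ffun k => if k == i then c else J k] M) r i
              = cofactor (1%:M : 'M[F]_l) r i.
      rewrite -M1 /cofactor; congr (_ * \det _); apply/matrixP=> x y.
      by rewrite !mxE ffunE eq_sym (negbTE (neq_lift _ _)).
    have /matrixP/(_ i r) := adj1 F l.
    by rewrite !mxE eq_sym.
  rewrite (bigD1 i) //= cf eqxx mulr1 big1 ?addr0 => [|r rn]; last first.
    by rewrite cf (negbTE rn) mulr0.
  by rewrite mxE ffunE eqxx.
move=> hA hB e; apply/matrixP=> i c.
by rewrite -(key A) // -(key B) // e.
Qed.

(** A non-zero minor selects columns [J] that are invertible in both matrices. Multiplying by the
    inverse blocks, whose determinants agree, reduces to [plu_eq1] without changing row spaces. *)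
Lemma plu_inj A B : row_free A -> plu A = plu B -> (A :=: B)%MS.
Proof.
move=> fA e.
have [j0 nz] : exists j, plu A 0 j != 0.
  apply/existsP; apply: contraR (plu_neq0 fA) => /existsPn h.
  by apply/eqP/rowP=> j; rewrite [RHS]mxE; apply/eqP; exact: negbNE (h j).
set J := fval j0.
have uA : colsub J A \in unitmx by move: nz; rewrite mxE unitmxE unitfE.
have uB : colsub J B \in unitmx by move: nz; rewrite e mxE unitmxE unitfE.
have dAB : \det (colsub J A) = \det (colsub J B).
  by have /rowP/(_ j0) := e; rewrite !mxE.
have colM (C : 'M[F]_l) M : colsub J (C *m M) = C *m colsub J M.
  by apply/matrixP=> i k; rewrite !mxE; apply: eq_bigr => s _; rewrite !mxE.
have eAB : invmx (colsub J A) *m A = invmx (colsub J B) *m B.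
  apply: (@plu_eq1 J); rewrite ?colM ?mulVmx //.
  by rewrite !plu_mull e !det_inv dAB.
have fu (C : 'M[F]_l) (M : 'M[F]_(l, a)) : C \in unitmx -> (invmx C *m M :=: M)%MS.
  by move=> uC; apply: eqmxMfull; rewrite row_full_unit unitmx_inv.
have := fu _ B uB; rewrite -eAB => h.
exact: eqmx_trans (eqmx_sym (fu _ A uA)) h.
Qed.

Lemma plu_eqmx A B : row_free A -> (A :=: B)%MS ->
  exists2 c, c != 0 & plu B = c *: plu A.
Proof.
move=> fA e.
have /submxP [C eB] : (B <= A)%MS by rewrite e.
exists (\det C); last by rewrite eB plu_mull.
have fB : row_free B by rewrite /row_free -e.
have := mxrankM_maxl C A; rewrite -eB; move: fB => /eqP ->.
by rewrite col_leq_rank -unitfE -unitmxE -row_full_unit.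
Qed.

End PluField.

(** * Relative increments of polynomials *)

(** The first conjunct discards the times at which [p] and its increment both vanish, where the
    inequality is void. *)
Definition jump (d : rat) (p : {poly rat}) (t : nat) : bool :=
  (p.[t.+1%:R] != p.[t%:R]) && (d * `|p.[t%:R]| <= `|p.[t.+1%:R] - p.[t%:R]|).

(** Each ratio [(1 + a) / a] is within [r] of 1, and the relative errors compound
    multiplicatively. *)
Lemma prod_shift_close (r : algC) (s : seq algC) :
  0 <= r -> all (fun a => 1 <= r * `|a|) s ->
  `|\prod_(a <- s) (1 + a) - \prod_(a <- s) a|
    <= ((1 + r) ^+ size s - 1) * `|\prod_(a <- s) a|.
Proof.
move=> r0; elim: s => [_|a s IH /= /andP [ra /IH {}IH]].
  by rewrite !big_nil !subrr normr0 mul0r.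
rewrite !big_cons; set Q := \prod_(j <- s) (1 + j) in IH *; set P := \prod_(j <- s) j in IH *.
have -> : (1 + a) * Q - a * P = (1 + a) * (Q - P) + P by ring.
apply: le_trans (ler_normD _ _) _; rewrite !normrM.
set c := (1 + r) ^+ size s - 1 in IH.
have -> : (1 + r) ^+ (size s).+1 - 1 = (1 + r) * c + r by rewrite exprS /c; ring.
have c0 : 0 <= c.
  by rewrite subr_ge0 exprn_ege1 // lerDl.
have h1 : `|1 + a| <= (1 + r) * `|a|.
  by apply: le_trans (ler_normD _ _) _; rewrite normr1 mulrDl mul1r addrC lerD2l.
have -> : ((1 + r) * c + r) * (`|a| * `|P|) =
    ((1 + r) * `|a|) * (c * `|P|) + (r * `|a|) * `|P| by ring.
apply: lerD; first exact: ler_pM.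
by rewrite ler_peMl.
Qed.

(** Two integers in the disc differ by less than [2 r], so all of them lie in a window of that
    length starting at the smallest. *)
Lemma count_near (z : algC) (r T : nat) :
  (count (fun t : nat => (`|t%:R - z| < r%:R)%R) (iota 0 T) <= r.*2)%N.
Proof.
set P := fun _ => _; rewrite -size_filter.
have us : uniq [seq t <- iota 0 T | P t] by rewrite filter_uniq ?iota_uniq.
have ss : sorted ltn [seq t <- iota 0 T | P t].
  by apply: sorted_filter (iota_ltn_sorted 0 T) => ? ? ?; apply: ltn_trans.
have al : all P [seq t <- iota 0 T | P t] by rewrite filter_all.
case: [seq t <- iota 0 T | P t] us ss al => [//|t0 s] us /= ss /andP [P0 al].
suff sub : {subset t0 :: s <= iota t0 r.*2}.
  by have := uniq_leq_size us sub; rewrite size_iota.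
move=> t; rewrite inE mem_iota => /orP [/eqP ->|ts].
  rewrite leqnn /= -addn1 leq_add2l double_gt0 lt0n; apply/eqP=> r0.
  by move: P0; rewrite /P r0 normr_lt0.
have lt0 : (t0 < t)%N.
  have /allP := order_path_min ltn_trans ss; exact.
rewrite (ltnW lt0) /=.
have Pt := allP al _ ts.
have : (`|t%:R - t0%:R| < (r.*2)%:R :> algC)%R.
  have -> : t%:R - t0%:R = (t%:R - z) - (t0%:R - z) :> algC by ring.
  apply: le_lt_trans (ler_normB _ _) _.
  by rewrite -addnn natrD ltrD.
rewrite -natrB ?(ltnW lt0) // normr_nat ltr_nat.
by lia.
Qed.

(** By convexity the power lies below its chord between [x = 0] and [x = 1]. *)
Lemma exp1D_le (x : rat) (D : nat) :
  0 <= x <= 1 -> (1 + x) ^+ D <= 1 + (2 ^+ D - 1) * x.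
Proof.
move=> /andP [x0 x1]; elim: D => [|D IH]; first by rewrite !expr0; lra.
have : (1 + x) * (1 + x) ^+ D <= (1 + x) * (1 + (2 ^+ D - 1) * x).
  by rewrite ler_wpM2l // addr_ge0.
rewrite !exprS => h; apply: le_trans h _.
have : 1 <= 2 ^+ D :> rat by rewrite exprn_ege1.
move: (2 ^+ D) => y y1.
have : 0 <= (y - 1) * (x * (1 - x)) by rewrite !mulr_ge0 ?subr_ge0.
by nra.
Qed.

(** Over [algC] the polynomial splits. At distance at least [R] from every root the relative
    increment is below [d], so each jump is within [R] of one of fewer than [D] roots, and
    [count_near] bounds the jumps near each. *)
Lemma count_jumps (D : nat) (d : rat) : 0 < d ->
  exists K : nat, forall p : {poly rat}, (size p <= D)%N ->
  forall T, (count (jump d p) (iota 0 T) <= K)%N.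
Proof.
move=> d0.
(* Large enough that [(1 + 1/R)^D - 1 <= (2^D - 1)/R < d]; the successor makes [R] positive. *)
pose R := (Num.bound (2 ^+ D / d)).+1.
have Rd : 2 ^+ D / d < R%:R.
  apply: lt_le_trans (archi_boundP _) _; last by rewrite ler_nat.
  by rewrite divr_ge0 ?exprn_ge0 // ltW.
have R0 : 0 < R%:R :> rat by rewrite ltr0n.
have cd : (1 + R%:R^-1) ^+ D - 1 < d.
  have : (1 + R%:R^-1) ^+ D <= 1 + (2 ^+ D - 1) * R%:R^-1 :> rat.
    by apply: exp1D_le; rewrite invr_ge0 ltW //= invf_le1 // ler1n.
  have : 0 <= R%:R^-1 :> rat by rewrite invr_ge0 ltW.
  have : 2 ^+ D * R%:R^-1 < d by rewrite ltr_pdivrMr // mulrC -ltr_pdivrMr.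
  by lra.
exists (D * R.*2)%N => p sp T.
have [p0|pn0] := eqVneq p 0.
  by rewrite (@eq_count _ _ pred0) ?count_pred0 // => t; rewrite /jump p0 !horner0 eqxx.
pose P := map_poly ratr p : {poly algC}.
have [s eP] := closed_field_poly_normal P.
have lc0 : lead_coef P != 0 by rewrite lead_coef_eq0 map_poly_eq0.
have ss : (size s < D)%N.
  apply: leq_trans sp; rewrite -(size_map_poly (ratr : {rmorphism rat -> algC})).
  by rewrite -/P eP size_scale // size_prod_XsubC.
have near t : jump d p t -> has (fun z => `|t%:R - z| < R%:R) s.
  move=> /andP [_ j2]; apply: contraLR j2; rewrite -all_predC => far.
  rewrite -ltNge -(ltr_rat algC) rmorphM /= !ratr_norm rmorphB /=.
  have ev (k : nat) : ratr p.[k%:R] = lead_coef P * \prod_(z <- s) (k%:R - z) :> algC.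
    have -> : ratr p.[k%:R] = P.[k%:R] :> algC by rewrite -horner_map /= rmorph_nat.
    rewrite {1}eP hornerZ horner_prod; congr (_ * _).
    by apply: eq_bigr => z _; rewrite hornerXsubC.
  rewrite !ev -mulrBr !normrM mulrCA ltr_pM2l ?normr_gt0 //.
  pose s' := [seq t%:R - z | z <- s].
  have -> : \prod_(z <- s) (t.+1%:R - z) = \prod_(a <- s') (1 + a) :> algC.
    by rewrite big_map; apply: eq_bigr => z _; rewrite -natr1; ring.
  have -> : \prod_(z <- s) (t%:R - z) = \prod_(a <- s') a :> algC by rewrite big_map.
  have Ra (a : algC) : a \in s' -> R%:R <= `|a|.
    by case/mapP=> z zs ->; have /= := allP far _ zs; rewrite -real_leNgt ?normr_real ?realn.
  have R0' : 0 < R%:R :> algC by rewrite ltr0n.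
  have := @prod_shift_close (R%:R^-1) s'.
  rewrite invr_ge0 ltW // => /(_ isT) h.
  apply: le_lt_trans (h _) _.
    by apply/allP=> a /Ra; rewrite ler_pdivlMl // mulr1.
  rewrite ltr_pM2r; last first.
    rewrite normr_gt0 prodf_seq_neq0; apply/allP=> a /Ra; apply: contraTneq => ->.
    by rewrite normr0 (lt_geF R0').
  apply: le_lt_trans (_ : ratr ((1 + R%:R^-1) ^+ D - 1) < _); last by rewrite ltr_rat.
  rewrite rmorphB rmorphXn rmorphD rmorph1 fmorphV rmorph_nat /= lerD2r.
  rewrite size_map ler_weXn2l //; last exact: ltnW.
  by rewrite lerDl invr_ge0 ltW.
have le1 : (count (jump d p) (iota 0 T) <=
    \sum_(z <- s) count (fun t : nat => (`|t%:R - z| < R%:R)%R) (iota 0 T))%N.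
  apply: leq_trans (sub_count near _) _.
  elim: (s) => [|z s' IH] /=; first by rewrite (@eq_count _ _ pred0) ?count_pred0.
  rewrite big_cons; apply: leq_trans (leq_add (leqnn _) IH).
  by rewrite -count_predUI leq_addr.
apply: leq_trans le1 _.
apply: leq_trans (_ : (\sum_(z <- s) R.*2 <= _)%N).
  by apply: leq_sum => z _; apply: count_near.
by rewrite big_const_seq count_predT iter_addn_0 mulnC leq_mul // ltnW.
Qed.

(** * Elementary matrices *)

Definition elt n (i j : 'I_n) (t : int) : 'M[int]_n := 1%:M + t *: delta_mx i j.

Inductive elementary n : 'M[int]_n -> Prop :=
| elementary1 : elementary 1%:M
| elementaryM g i j t : i != j -> elementary g -> elementary (g *m elt i j t).

Lemma eltD n (i j : 'I_n) (s t : int) : i != j ->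
  elt i j s *m elt i j t = elt i j (s + t).
Proof.
move=> ij; rewrite /elt mulmxDl mul1mx mulmxDr mulmx1 -scalemxAl -scalemxAr.
by rewrite mul_delta_mx_0 1?eq_sym // !scaler0 addr0 scalerDl -addrA [t *: _ + _]addrC.
Qed.

Lemma elt0 n (i j : 'I_n) : elt i j 0 = 1%:M.
Proof. by rewrite /elt scale0r addr0. Qed.

Lemma mulmx_eltE n (r : 'rV[int]_n) (i j : 'I_n) (t : int) k :
  (r *m elt i j t) 0 k = r 0 k + (r 0 i * t) *+ (k == j).
Proof.
rewrite mulmxDr mulmx1 -scalemxAr !mxE; congr (_ + _).
rewrite (bigD1 i) //= big1 => [|s si]; last by rewrite mxE (negbTE si) mulr0.
by rewrite mxE eqxx addr0 /=; case: (k == j); rewrite ?mulr1 ?mulr0n ?mulr0 // mulrC.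
Qed.

Section Elementary.
Variable n : nat.
Implicit Types a b g : 'M[int]_n.

Lemma elementary_elt (i j : 'I_n) t : i != j -> elementary (elt i j t).
Proof. by move=> ij; rewrite -[elt i j t]mul1mx; apply: elementaryM => //; apply: elementary1. Qed.

Lemma elementary_mul a b : elementary a -> elementary b -> elementary (a *m b).
Proof.
move=> ea; elim=> [|{}b i j t ij _ IH]; first by rewrite mulmx1.
by rewrite mulmxA; apply: elementaryM.
Qed.

Lemma elementary_inv a : elementary a ->
  exists2 b, elementary b & a *m b = 1%:M.
Proof.
elim=> [|{}a i j t ij _ [b eb ab]].
  by exists 1%:M; [apply: elementary1 | rewrite mulmx1].
exists (elt i j (- t) *m b); first exact/elementary_mul/eb/elementary_elt.
by rewrite mulmxA -[_ *m elt i j (-t)]mulmxA eltD // subrr elt0 mulmx1.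
Qed.

Lemma elementary_det a : elementary a -> \det a = 1.
Proof.
have det_elt (i j : 'I_n) t : i != j -> \det (elt i j t) = 1.
  move=> ij; wlog ji : i j ij / (j < i)%N => [h|].
    case: (ltngtP i j) => [lt|lt|/val_inj e]; last by rewrite e eqxx in ij.
      rewrite -det_tr /elt linearD /= trmx1 linearZ /= trmx_delta.
      by apply: h => //; rewrite eq_sym.
    exact: h.
  rewrite det_trig; last first.
    apply/is_trig_mxP=> x y xy; rewrite !mxE.
    have -> : (x == y) = false by apply/eqP=> e; rewrite e ltnn in xy.
    have -> : (x == i) && (y == j) = false.
      by apply/negP=> /andP [/eqP ex /eqP ey]; move: xy; rewrite ex ey; lia.
    by rewrite mulr0 addr0.
  apply: big1 => x _; rewrite !mxE eqxx.
  have -> : (x == i) && (x == j) = false.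
    by apply/negP=> /andP [/eqP -> e]; rewrite e in ij.
  by rewrite mulr0 addr0.
elim=> [|{}a i j t ij _ IH]; first exact: det1.
by rewrite det_mulmx IH det_elt // mulr1.
Qed.

(** Euclid's algorithm: as long as two entries are non-zero, adding or subtracting the smaller one
    lowers the sum of the absolute values. *)
Lemma row_reduce (r : 'rV[int]_n) :
  exists2 h, elementary h & forall i j, (r *m h) 0 i != 0 -> (r *m h) 0 j != 0 -> i = j.
Proof.
have [N le] := ubnP (\sum_i `|r 0%R i|)%N.
elim: N r le => // N IH r le.
have [/existsP [i /existsP [j /and4P [ij ri rj rij]]]|] :=
    boolP [exists i, exists j, [&& i != j, r 0 i != 0, r 0 j != 0 & (`|r 0%R j| <= `|r 0%R i|)%N]];
    last first.
  move=> /existsPn no; exists 1%:M => [|i j]; first exact: elementary1.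
  rewrite mulmx1 => ri rj; apply/eqP; apply/negPn/negP => ij.
  have := no i; have := no j => /existsPn/(_ i) + /existsPn/(_ j).
  rewrite ri rj ij eq_sym ij /=; lia.
(* The sign that makes [r 0 i + t * r 0 j] smaller in absolute value than [r 0 i]. *)
pose t : int := if (0 <= r 0 i) == (0 <= r 0 j) then -1 else 1.
have [|h eh hh] := IH (r *m elt j i t); last first.
- exists (elt j i t *m h); last by move=> x y; rewrite mulmxA; apply: hh.
  by apply: elementary_mul => //; apply: elementary_elt; rewrite eq_sym.
- apply: leq_trans (_ : \sum_i `|r 0%R i| <= _)%N; last by rewrite -ltnS.
  rewrite (bigD1 i) // [X in (_ < X)%N](bigD1 i) //= mulmx_eltE eqxx mulr1n.
  rewrite -addSn leq_add //; last first.
    apply: leq_sum => k ki; rewrite mulmx_eltE (negbTE ki) mulr0n addr0 //.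
  rewrite /t; move: (r 0 i) (r 0 j) ri rj rij => x y x0 y0 yx.
  have [->|->] : y = `|y|%N%:Z \/ y = - `|y|%N%:Z by lia.
    have [->|->] : x = `|x|%N%:Z \/ x = - `|x|%N%:Z by lia.
      by rewrite /=; lia.
    by case: eqP => e; lia.
  by case: eqP => e; lia.
Qed.

End Elementary.

Lemma elementary_lift m (g : 'M[int]_m) :
  elementary g -> elementary (block_mx 1 0 0 g : 'M[_]_(1 + m)).
Proof.
elim=> [|{}g i j t ij _ IH].
  by rewrite -scalar_mx_block; apply: elementary1.
have -> : block_mx 1 0 0 (g *m elt i j t) = block_mx 1 0 0 g *m
   elt (rshift 1 i) (rshift 1 j) t :> 'M[_]_(1 + m).
  have -> : elt (rshift 1 i) (rshift 1 j) t = block_mx 1 0 0 (elt i j t) :> 'M[_]_(1 + m).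
    rewrite /elt [in LHS]scalar_mx_block delta_mx_dshift delta_mx_rshift.
    rewrite -[X in col_mx X _]row_mx0 -block_mxEv scale_block_mx add_block_mx.
    by rewrite !scaler0 !addr0.
  by rewrite mulmx_block !mulmx0 !mul0mx !mulmx1 !addr0 !add0r.
apply: elementaryM IH.
by rewrite (inj_eq (@rshift_inj _ _)).
Qed.

Lemma elementary_lower m (c : 'cV[int]_m) :
  elementary (block_mx 1 0 c 1%:M : 'M[_]_(1 + m)).
Proof.
rewrite [c]matrix_sum_delta.
apply: (big_ind (fun c => elementary (block_mx 1 0 c 1%:M : 'M[_]_(1 + m)))).
- by rewrite -scalar_mx_block; apply: elementary1.
- move=> x y ex ey; have := elementary_mul ex ey.
  by rewrite mulmx_block !mulmx0 !mul0mx !mulmx1 !mul1mx !addr0 !add0r.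
move=> i _; rewrite big_ord1.
have -> : block_mx 1 0 (c i 0 *: delta_mx i 0) 1%:M = elt (rshift 1 i) (lshift m 0) (c i 0).
  rewrite /elt [in RHS]scalar_mx_block delta_mx_dshift delta_mx_lshift.
  rewrite -[X in col_mx X _]row_mx0 -block_mxEv scale_block_mx add_block_mx.
  by rewrite !scaler0 !addr0 !add0r.
apply: elementary_elt.
by rewrite eq_sym eq_lrshift.
Qed.

(** Column operations bring the first row to the first basis vector. The matrix is then a lower
    unipotent times a block matrix with a smaller matrix of determinant 1, to which induction
    applies. *)
Lemma SL_elementary n (g : 'M[int]_n) : \det g = 1 -> elementary g.
Proof.
elim: n g => [|m IH] g dg.
  by rewrite [g]flatmx0 -[X in elementary X](flatmx0 1%:M); apply: elementary1.
suff [h eh hr] : exists2 h, elementary h & row 0 (g *m h) = delta_mx 0 0.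
  have [h' eh' hh'] := elementary_inv eh.
  have -> : g = (g *m h) *m h' by rewrite -mulmxA hh' mulmx1.
  apply: elementary_mul => //.
  have dgh : \det (g *m h) = 1 by rewrite det_mulmx dg (elementary_det eh) mulr1.
  move: (g *m h) hr dgh => {}g hr {}dg.
  have eg : g = block_mx 1 0 (dlsubmx (g : 'M[_]_(1 + m))) (drsubmx (g : 'M[_]_(1 + m))).
    have e1 : ulsubmx (g : 'M[_]_(1 + m)) = 1.
      apply/matrixP=> i j; rewrite !ord1 !mxE.
      have /rowP/(_ 0) := hr; rewrite !mxE /= => <-.
      by congr (g _ _); apply: val_inj.
    have e2 : ursubmx (g : 'M[_]_(1 + m)) = 0.
      apply/matrixP=> i j; rewrite !ord1 !mxE.
      have /rowP/(_ (rshift 1 j)) := hr; rewrite !mxE => hj.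
      by apply: etrans hj; congr (g _ _); apply: val_inj.
    by rewrite -{1}[g](@submxK _ 1 m 1 m) e1 e2.
  move: dg; rewrite {1}eg => dg.
  have {}dg : \det (drsubmx (g : 'M[_]_(1 + m))) = 1.
    by have := dg; rewrite (@det_lblock _ 1 m) det1 mul1r.
  have -> : g = block_mx 1 0 (dlsubmx (g : 'M[_]_(1 + m))) 1%:M
       *m block_mx 1 0 0 (drsubmx (g : 'M[_]_(1 + m))) :> 'M[_]_(1 + m).
    by rewrite {1}eg mulmx_block !mulmx0 !mul0mx !mulmx1 !mul1mx !addr0 !add0r.
  exact: (elementary_mul (elementary_lower _) (elementary_lift (IH _ dg))).
have [h eh hu] := row_reduce (row 0 g).
have dgh : \det (g *m h) = 1 by rewrite det_mulmx dg (elementary_det eh) mulr1.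
rewrite -row_mul in hu.
suff [h' eh' hr] : exists2 h', elementary h' & row 0 (g *m h) *m h' = delta_mx 0 0.
  by exists (h *m h'); [apply: elementary_mul | rewrite mulmxA row_mul].
move: (g *m h) hu dgh => {eh h dg}g hu dg.
have [j rj] : exists j, row 0 g 0 j != 0.
  apply/existsP; apply: contra_eqT dg => /existsPn r0.
  rewrite (expand_det_row _ 0) big1 // => j _.
  by have := r0 j; rewrite negbK mxE => /eqP ->; rewrite mul0r.
have oth k : k != j -> row 0 g 0 k = 0.
  by move=> kj; apply/eqP; apply: contraNT kj => /hu /(_ rj) ->.
have a1 : row 0 g 0 j = 1 \/ row 0 g 0 j = -1.
  have : row 0 g 0 j \is a GRing.unit.
    apply/unitrPr; exists (cofactor g 0 j); rewrite -dg (expand_det_row _ 0).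
    rewrite (bigD1 j) //= mxE big1 ?addr0 // => k /oth; rewrite mxE => ->.
    by rewrite mul0r.
  by rewrite qualifE /= /intUnitRing.unitz => /orP [] /eqP ->; [left | right].
have delE (k : 'I_m.+1) : (delta_mx 0 0 : 'rV[int]_m.+1) 0 k = (k == 0)%:R.
  by rewrite mxE eqxx.
have [j0|j0] := eqVneq j 0; last first.
  (* With [a = 1] or [a = -1] at place [j], the first factor puts [a * a = 1] at place 0 and the
     second clears place [j]. *)
  exists (elt j 0 (row 0 g 0 j) *m elt 0 j (- row 0 g 0 j)).
    by apply: elementary_mul; apply: elementary_elt; rewrite // eq_sym.
  apply/rowP=> k; rewrite mulmxA !mulmx_eltE delE.
  have r0 : row 0 g 0 0 = 0 by rewrite oth // eq_sym.
  rewrite eqxx r0 add0r mulr1n.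
  have [->|k0] := eqVneq k 0.
    by rewrite r0 [0 == j]eq_sym (negbTE j0); case: a1 => ->; rewrite /= ?mulr1n ?mulr0n; lia.
  have [->|kj] := eqVneq k j; last first.
    by rewrite (oth k kj) !add0r.
  by case: a1 => ->; rewrite /= ?mulr1n ?mulr0n; lia.
case: a1 => a1.
  exists 1%:M; first exact: elementary1.
  apply/rowP=> k; rewrite mulmx1 delE.
  have [->|k0] := eqVneq k 0; first by rewrite j0 in a1; rewrite a1.
  by rewrite oth // j0.
case: m IH g hu dg j rj oth a1 delE j0 => [|m] IH g hu dg j rj oth a1 delE j0.
  by move: dg; rewrite det_mx11; move: a1; rewrite mxE ord1 => ->.
subst j; pose o : 'I_m.+2 := 1.
(* On the places [(0, o)]: [(-1, 0)], then [(-1, -1)], then [(1, -1)], then [(1, 0)]. *)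
exists (elt 0 o 1 *m elt o 0 (-2) *m elt 0 o 1).
  by do 2?apply: elementary_mul; apply: elementary_elt.
apply/rowP=> k; rewrite !mulmxA !mulmx_eltE delE a1 (oth o) //=.
have [->|k0] := eqVneq k 0; first by rewrite a1.
by have [->|ko] := eqVneq k o; rewrite oth.
Qed.

(** * A criterion for a spectral gap *)

(** Finitely supported functions on an infinite set are summed over any duplicate-free list that
    contains the support; the choice of list is immaterial. *)
Lemma sum_supp_eq (K : zmodType) (Om : eqType) (D1 D2 : seq Om) (f : Om -> K) :
  uniq D1 -> uniq D2 -> (forall x, f x != 0 -> x \in D1) ->
  (forall x, f x != 0 -> x \in D2) ->
  \sum_(x <- D1) f x = \sum_(x <- D2) f x.
Proof.
move=> u1 u2 s1 s2.
have flt D : \sum_(x <- D) f x = \sum_(x <- [seq x <- D | f x != 0]) f x.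
  rewrite big_filter [LHS](bigID (fun x => f x == 0)) /= big1 ?add0r //.
  by move=> x /eqP.
rewrite flt [RHS]flt; apply: perm_big; apply: uniq_perm; rewrite ?filter_uniq //.
move=> x; rewrite !mem_filter; case: (boolP (f x != 0)) => //= fx.
by rewrite s1 // s2.
Qed.

Lemma sum_supp_reindex (K : zmodType) (Om : eqType) (D : seq Om) (f : Om -> K)
    (phi psi : Om -> Om) : cancel phi psi -> cancel psi phi ->
  uniq D -> (forall x, f x != 0 -> x \in D) ->
  (forall x, f (phi x) != 0 -> x \in D) ->
  \sum_(x <- D) f (phi x) = \sum_(x <- D) f x.
Proof.
move=> c1 c2 u s1 s2; rewrite -(big_map phi predT f).
apply: sum_supp_eq => //.
  by rewrite map_inj_uniq //; apply: can_inj c1.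
move=> x fx; apply/mapP; exists (psi x); last by rewrite c2.
by apply: s2; rewrite c2.
Qed.

(** The variance identity. It expresses the loss of norm under averaging through the displacements
    between pairs of generators. *)
Lemma sqr_sum_diff (K : realFieldType) (T : Type) (s : seq T) (y : T -> K) :
  (\sum_(a <- s) y a) ^+ 2 =
  (size s)%:R * \sum_(a <- s) y a ^+ 2
  - 2^-1 * \sum_(a <- s) \sum_(b <- s) (y a - y b) ^+ 2.
Proof.
have -> : \sum_(a <- s) \sum_(b <- s) (y a - y b) ^+ 2 =
    \sum_(a <- s) ((size s)%:R * y a ^+ 2 + \sum_(b <- s) y b ^+ 2
       + - 2 * (y a * \sum_(b <- s) y b)).
  apply: eq_bigr => a _.
  have -> : (size s)%:R * y a ^+ 2 = \sum_(b <- s) y a ^+ 2.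
    by rewrite big_const_seq count_predT iter_addr addr0 mulr_natl.
  rewrite mulr_sumr mulr_sumr -!big_split /=.
  by apply: eq_bigr => b _; ring.
rewrite !big_split /= -mulr_sumr -mulr_sumr -mulr_suml.
rewrite big_const_seq count_predT iter_addr addr0 -mulr_natl.
by field.
Qed.

Section AbstractGap.
Variables (K : realFieldType) (Om T : eqType) (S : seq T) (sg : T -> Om -> Om).
Hypothesis sgV : forall a, a \in S ->
  exists2 b, b \in S & cancel (sg a) (sg b) /\ cancel (sg b) (sg a).

Definition actw (w : seq T) (x : Om) : Om := foldl (fun x a => sg a x) x w.

Lemma actw_cat v w x : actw (v ++ w) x = actw w (actw v x).
Proof. by rewrite /actw foldl_cat. Qed.

Lemma actwV w : all (mem S) w -> exists v, [/\ all (mem S) v, size v = size w,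
  cancel (actw w) (actw v) & cancel (actw v) (actw w)].
Proof.
elim: w => [|a w IH] /=; first by exists [::].
move=> /andP [/sgV [b bS [ab ba]] /IH [v [vS sv wv vw]]].
exists (rcons v b); split; rewrite ?size_rcons ?sv //.
- by rewrite all_rcons /= bS.
- by move=> x; rewrite -cats1 actw_cat /= wv ab.
- by move=> x; rewrite -cats1 actw_cat /= ba vw.
Qed.

(** [D] contains the support of every translate of [f] by a word of length at most [H], so one list
    serves for all changes of variable by such words. *)
Definition wsupp (D : seq Om) (H : nat) (f : Om -> K) :=
  forall w, all (mem S) w -> (size w <= H)%N ->
  forall x, f (actw w x) != 0 -> x \in D.

Fixpoint words (H : nat) : seq (seq T) :=
  if H is H'.+1 then [::] :: [seq a :: w | a <- S, w <- words H'] else [:: [::]].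

Lemma mem_words H w : all (mem S) w -> (size w <= H)%N -> w \in words H.
Proof.
elim: H w => [|H IH] [|a w] //= /andP [aS wS] sw.
by rewrite inE; apply/orP; right; apply: allpairs_f => //; apply: IH.
Qed.

Lemma wsupp_ex H (D0 : seq Om) (f : Om -> K) : (forall x, f x != 0 -> x \in D0) ->
  exists2 D, uniq D & wsupp D H f.
Proof.
move=> s0; exists (undup [seq actw w x | w <- words H, x <- D0]).
  exact: undup_uniq.
move=> w wS sw x fx; rewrite mem_undup.
have [v [vS sv wv vw]] := actwV wS.
rewrite -[x]wv; apply: allpairs_f; last exact: s0.
by apply: mem_words; rewrite ?sv.
Qed.

Lemma sqr_diff_neq0 (u v : K) : (u - v) ^+ 2 != 0 -> u != 0 \/ v != 0.
Proof.
move=> h; have [u0|un] := eqVneq u 0; last by left.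
have [v0|vn] := eqVneq v 0; last by right.
by rewrite u0 v0 subrr expr0n eqxx in h.
Qed.

Lemma sqrD_le (u v : K) : (u + v) ^+ 2 <= 2 * u ^+ 2 + 2 * v ^+ 2.
Proof. by have := sqr_ge0 (u - v); nra. Qed.

Section WithF.
Variables (D : seq Om) (H : nat) (f : Om -> K).
Hypotheses (uD : uniq D) (sD : wsupp D H f).

Let disp := \sum_(a <- S) \sum_(b <- S) \sum_(x <- D) (f (sg a x) - f (sg b x)) ^+ 2.

Lemma wsupp0 x : f x != 0 -> x \in D.
Proof. exact: (sD (w := [::])). Qed.

(** Substituting [y = sg a x] turns the difference into [f (sg b y) - f (sg a' y)], with [a']
    inverse to [a], which is a term of [disp]. The displacement thus controls pairs of letters,
    hence words of even length. *)
Lemma disp_pair a b : (2 <= H)%N -> a \in S -> b \in S ->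
  \sum_(x <- D) (f (sg b (sg a x)) - f x) ^+ 2 <= disp.
Proof.
move=> H2 aS bS; have [a' a'S [aa' a'a]] := sgV aS.
pose h y := (f (sg b y) - f (sg a' y)) ^+ 2.
have -> : \sum_(x <- D) (f (sg b (sg a x)) - f x) ^+ 2 = \sum_(x <- D) h (sg a x).
  by apply: eq_bigr => x _; rewrite /h aa'.
have s1 c x : c \in S -> f (sg c x) != 0 -> x \in D.
  by move=> cS; apply: (sD (w := [:: c])) => //=; [rewrite cS | apply: ltnW].
rewrite (sum_supp_reindex aa' a'a) //.
- rewrite /disp (big_rem b) //= (big_rem a') //= -addrA lerDl addr_ge0 //.
    by apply: sumr_ge0 => c _; apply: sumr_ge0 => x _; apply: sqr_ge0.
  apply: sumr_ge0 => c _; apply: sumr_ge0 => d _; apply: sumr_ge0 => x _.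
  exact: sqr_ge0.
- by move=> x /sqr_diff_neq0 [] /s1; apply.
- move=> x /sqr_diff_neq0 []; first by apply: (sD (w := [:: a; b])); rewrite //= aS bS.
  by rewrite aa'; apply: wsupp0.
Qed.

Lemma disp_ge0 : 0 <= disp.
Proof.
by apply: sumr_ge0 => c _; apply: sumr_ge0 => d _; apply: sumr_ge0 => x _; apply: sqr_ge0.
Qed.

Lemma disp_word (l : nat) w : all (mem S) w -> size w = l.*2 -> (l.*2 <= H)%N ->
  \sum_(x <- D) (f (actw w x) - f x) ^+ 2 <= 4 ^+ l * disp.
Proof.
elim: l w => [|l IH] w.
  move=> _ /size0nil -> _; rewrite mul1r big1 ?disp_ge0 // => x _ /=.
  by rewrite subrr expr0n.
case: w => [//|a [//|b w]] /= /and3P [aS bS wS] [sw] lH.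
have lH' : (l.*2 <= H)%N by lia.
have abS : all (mem S) [:: a; b] by rewrite /= aS bS.
have [v [vS sv c1 c2]] := actwV abS.
have step : \sum_(x <- D) (f (actw w (actw [:: a; b] x)) - f x) ^+ 2 <=
   2 * \sum_(x <- D) (f (actw w (actw [:: a; b] x)) - f (actw [:: a; b] x)) ^+ 2
   + 2 * \sum_(x <- D) (f (sg b (sg a x)) - f x) ^+ 2.
  rewrite !mulr_sumr -big_split /=; apply: ler_sum => x _.
  have := sqrD_le (f (actw w (sg b (sg a x))) - f (sg b (sg a x))) (f (sg b (sg a x)) - f x).
  by congr (_ ^+ 2 <= _); ring.
apply: le_trans step _.
pose h y := (f (actw w y) - f y) ^+ 2.
have -> : \sum_(x <- D) (f (actw w (actw [:: a; b] x)) - f (actw [:: a; b] x)) ^+ 2 =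
    \sum_(x <- D) h x.
  apply: (sum_supp_reindex c1 c2 uD).
    move=> x /sqr_diff_neq0 []; last exact: wsupp0.
    by apply: sD => //; rewrite sw.
  move=> x /sqr_diff_neq0 [].
    rewrite -actw_cat; apply: sD; first by rewrite /= aS bS.
    by rewrite /= sw; lia.
  by apply: sD; rewrite /= ?aS ?bS //; lia.
have H2 : (2 <= H)%N by lia.
have := IH w wS sw lH'; have := disp_pair H2 aS bS.
rewrite exprS => h1 h2.
have := disp_ge0.
have : 1 <= 4 ^+ l :> K by rewrite exprn_ege1 // ler1n.
move: (4 ^+ l) h2 => c h2 c1' d0.
have : 0 <= (c - 1) * disp by rewrite mulr_ge0 // subr_ge0.
rewrite /h in h2 *; lra.
Qed.

Lemma actw_iter U t x : iter t (actw U) x = actw (flatten (nseq t U)) x.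
Proof.
elim: t x => [//|t IH] x.
by rewrite iterSr IH /= actw_cat.
Qed.

(** For each [t < N] the mass of [f] on [A] equals the sum of [f (U^t x)^2] over the [x] with
    [U^t x] in [A]. Replacing [f (U^t x)] by [f x] costs a displacement, and summed over [t] each
    [x] counts at most [k] times. *)
Lemma visit_bound U (l N : nat) (A : pred Om) (k : nat) :
  all (mem S) U -> size U = l.*2 -> ((N * l).*2 <= H)%N ->
  (forall x, (count (fun t => A (iter t (actw U) x)) (iota 0 N) <= k)%N) ->
  N%:R * \sum_(x <- D | A x) f x ^+ 2
    <= 2 * k%:R * \sum_(x <- D) f x ^+ 2 + 2 * N%:R * 4 ^+ (N * l) * disp.
Proof.
move=> US sU NH cnt.
have step t : (t < N)%N -> \sum_(x <- D | A x) f x ^+ 2 <=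
    2 * \sum_(x <- D) f x ^+ 2 * (A (iter t (actw U) x))%:R + 2 * (4 ^+ (N * l) * disp).
  move=> tN; set V := flatten (nseq t U).
  have VS : all (mem S) V by apply/allP=> a /flattenP [u /nseqP [-> _]]; apply: (allP US).
  have sV : size V = (t * l).*2.
    by rewrite size_flatten /shape map_nseq sumn_nseq sU; lia.
  have tl : (t * l <= N * l)%N by rewrite leq_mul2r ltnW ?orbT.
  have VH : ((t * l).*2 <= H)%N by lia.
  have [v [vS sv c1 c2]] := actwV VS.
  pose h x := (A x)%:R * f x ^+ 2.
  have -> : \sum_(x <- D | A x) f x ^+ 2 = \sum_(x <- D) h x.
    by rewrite big_mkcond; apply: eq_bigr => x _; rewrite /h; case: (A x); rewrite ?mul1r ?mul0r.
  have hf x : h x != 0 -> f x != 0.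
    by apply: contraNneq => e; rewrite /h e expr0n mulr0.
  rewrite -(sum_supp_reindex c1 c2 uD); last first.
  - by move=> x /hf; apply: sD => //; rewrite sV.
  - by move=> x /hf; apply: wsupp0.
  have le1 : \sum_(x <- D) h (actw V x) <= 2 * \sum_(x <- D) f x ^+ 2 * (A (iter t (actw U) x))%:R
     + 2 * \sum_(x <- D) (f (actw V x) - f x) ^+ 2.
    rewrite !mulr_sumr -big_split /=; apply: ler_sum => x _.
    rewrite actw_iter -/V /h; case: (A _); rewrite ?mul1r ?mul0r ?mulr1 ?mulr0 ?add0r.
      by have := sqrD_le (f x) (f (actw V x) - f x); congr (_ ^+ 2 <= _); ring.
    by rewrite mulr_ge0 // sqr_ge0.
  apply: le_trans le1 _; rewrite lerD2l ler_pM2l //.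
  apply: le_trans (disp_word VS sV VH) _; rewrite ler_wpM2r ?disp_ge0 //.
  by rewrite ler_weXn2l // ler1n.
have : \sum_(t <- iota 0 N) \sum_(x <- D | A x) f x ^+ 2 <=
   \sum_(t <- iota 0 N) (2 * \sum_(x <- D) f x ^+ 2 * (A (iter t (actw U) x))%:R + 2 * (4 ^+ (N * l) * disp)).
  by rewrite !big_seq; apply: ler_sum => t; rewrite mem_iota => tN; apply: step.
rewrite big_const_seq count_predT size_iota iter_addr addr0 -[_ *+ N]mulr_natl => h.
apply: le_trans h _; rewrite big_split /= big_const_seq count_predT size_iota iter_addr addr0.
apply: lerD; last by rewrite -[_ *+ N]mulr_natl le_eqVlt; apply/orP; left; apply/eqP; ring.
rewrite -mulr_sumr -mulrA ler_pM2l // exchange_big mulr_sumr /=.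
apply: ler_sum => x _; rewrite -mulr_sumr mulrC ler_wpM2r ?sqr_ge0 //.
rewrite -natr_sum ler_nat; apply: leq_trans (cnt x).
by rewrite -sum1_count [leqRHS]big_mkcond; apply: leq_sum => t _; case: (A _).
Qed.

End WithF.

Variables (I : finType) (U : I -> seq T) (A : I -> pred Om) (k : nat).
Hypotheses (S0 : (0 < size S)%N)
  (US : forall e, all (mem S) (U e)) (Ueven : forall e, ~~ odd (size (U e)))
  (visits : forall e x N, (count (fun t => A e (iter t (actw (U e)) x)) (iota 0 N) <= k)%N)
  (cover : forall x, exists e, A e x).

Definition avg (f : Om -> K) (x : Om) : K := (size S)%:R^-1 * \sum_(a <- S) f (sg a x).

(** Summing [visit_bound] over the cover bounds the squared norm of [f] by half of itself plus a
    multiple of the displacement; the variance identity then shows that averaging contracts. *)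
Lemma abstract_gap : exists r : K, [/\ 0 <= r, r < 1 &
  forall (f : Om -> K) (D0 : seq Om), (forall x, f x != 0 -> x \in D0) ->
  exists D, [/\ uniq D, forall x, f x != 0 -> x \in D,
    forall x, avg f x != 0 -> x \in D &
    \sum_(x <- D) avg f x ^+ 2 <= r * \sum_(x <- D) f x ^+ 2]].
Proof.
pose l := (\max_e (size (U e))./2)%N.
(* Chosen so that the visits, [2 |I| k] times the squared norm, take at most half of [N] times
   it. *)
pose N := (4 * #|I| * k).+1.
pose C : K := 4 * (#|I|.+1)%:R * 4 ^+ (N * l).
pose s : K := (size S)%:R.
have s1 : 1 <= s by rewrite ler1n.
have C1 : 1 <= C.
  have h1 : 1 <= 4 ^+ (N * l) :> K by rewrite exprn_ege1 // ler1n.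
  have h2 : 1 <= #|I|.+1%:R :> K by rewrite ler1n.
  by rewrite /C; nra.
have sC1 : 1 <= s ^+ 2 * C.
  by rewrite -[1]mulr1 ler_pM // exprn_ege1.
exists (1 - (2 * (s ^+ 2 * C))^-1); split.
- by rewrite subr_ge0 invf_le1; lra.
- by rewrite ltrBlDr ltrDl invr_gt0; lra.
move=> f D0 s0.
(* The extra 2 ensures that single letters are covered even when [N * l = 0]. *)
have [D uD sD] := wsupp_ex ((N * l).*2 + 2) s0.
pose disp := \sum_(a <- S) \sum_(b <- S) \sum_(x <- D) (f (sg a x) - f (sg b x)) ^+ 2.
have sup1 a x : a \in S -> f (sg a x) != 0 -> x \in D.
  by move=> aS; apply: (sD [:: a]); rewrite /= ?aS //; lia.
exists D; split=> //; first exact: wsupp0 sD.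
  move=> x; rewrite /avg mulf_eq0 negb_or => /andP [_ ne].
  have /hasP [a aS fa] : has (fun a => f (sg a x) != 0) S.
    apply: contraNT ne; rewrite -all_predC => /allP h.
    by rewrite big_seq big1 // => a /h /=; rewrite negbK => /eqP.
  exact: sup1 aS fa.
have key : \sum_(x <- D) f x ^+ 2 <= C * disp.
  have le1 : \sum_(x <- D) f x ^+ 2 <= \sum_e \sum_(x <- D | A e x) f x ^+ 2.
    under [leRHS]eq_bigr do rewrite big_mkcond.
    rewrite exchange_big; apply: ler_sum => x _.
    have [e Ae] := cover x; rewrite (bigD1 e) //= Ae lerDl.
    by apply: sumr_ge0 => e' _; case: ifP => // _; apply: sqr_ge0.
  have le2 e : N%:R * \sum_(x <- D | A e x) f x ^+ 2
    <= 2 * k%:R * \sum_(x <- D) f x ^+ 2 + 2 * N%:R * 4 ^+ (N * l) * disp.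
    have sU : size (U e) = (size (U e))./2.*2 by rewrite even_halfK.
    have le_l : ((size (U e))./2 <= l)%N.
      exact: (leq_bigmax_cond (F := fun e => (size (U e))./2)).
    have le_Nl : (N * (size (U e))./2 <= N * l)%N by rewrite leq_mul2l le_l orbT.
    apply: le_trans (visit_bound uD sD (US e) sU _ (visits e ^~ N)) _; first by lia.
    rewrite lerD2l -!mulrA !ler_wpM2l // ler_wpM2r ?disp_ge0 //.
    by rewrite ler_weXn2l // ler1n.
  have : N%:R * \sum_(x <- D) f x ^+ 2 <= #|I|%:R *
     (2 * k%:R * \sum_(x <- D) f x ^+ 2 + 2 * N%:R * 4 ^+ (N * l) * disp).
    apply: le_trans (ler_wpM2l (ler0n _ _) le1) _.
    move: le2; set X := _ + _ => le2.
    apply: le_trans (_ : \sum_(e : I) X <= _); last by rewrite sumr_const mulr_natl.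
    by rewrite mulr_sumr; apply: ler_sum => e _; apply: le2.
  have F0 : 0 <= \sum_(x <- D) f x ^+ 2 by apply: sumr_ge0 => x _; apply: sqr_ge0.
  have d0 : 0 <= disp by apply: disp_ge0.
  have NE : N%:R = 4 * #|I|%:R * k%:R + 1 :> K by rewrite /N -natr1 !natrM.
  rewrite /C -natr1; set F := \sum_(x <- D) _ in F0 *.
  have N0 : 0 < N%:R :> K by rewrite ltr0n.
  have i0 : 0 <= #|I|%:R :> K by rewrite ler0n.
  have p0 : 0 <= 4 ^+ (N * l) * disp by rewrite mulr_ge0 // exprn_ge0.
  move: (4 ^+ (N * l)) p0 => c p0 h.
  have h2 : 2 * #|I|%:R * k%:R * F <= 2^-1 * (N%:R * F).
    by rewrite NE; nra.
  have h3 : N%:R * F <= N%:R * (4 * (#|I|%:R * (c * disp))) by nra.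
  rewrite ler_pM2l // in h3; apply: le_trans h3 _.
  by have := p0; nra.
have -> : \sum_(x <- D) avg f x ^+ 2 = \sum_(x <- D) f x ^+ 2 - (2 * s ^+ 2)^-1 * disp.
  have -> : \sum_(x <- D) avg f x ^+ 2 = s ^- 2 * \sum_(x <- D) (\sum_(a <- S) f (sg a x)) ^+ 2.
    by rewrite mulr_sumr; apply: eq_bigr => x _; rewrite /avg exprMn exprVn.
  under eq_bigr do rewrite sqr_sum_diff.
  rewrite sumrB -!mulr_sumr exchange_big /=.
  have -> : \sum_(j <- S) \sum_(i <- D) f (sg j i) ^+ 2 = s * \sum_(x <- D) f x ^+ 2.
    rewrite (@eq_big_seq _ _ _ _ _ _ (fun=> \sum_(x <- D) f x ^+ 2)).
      by rewrite big_const_seq count_predT iter_addr addr0 mulr_natl.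
    move=> a aS; have [b bS [ab ba]] := sgV aS.
    have nz u : u ^+ 2 != 0 -> u != 0 :> K by rewrite sqrf_eq0.
    apply: (sum_supp_reindex (f := fun x => f x ^+ 2) ab ba uD) => x /nz; first exact: (wsupp0 sD).
    exact: sup1.
  have -> : \sum_(i <- D) \sum_(a <- S) \sum_(b <- S) (f (sg a i) - f (sg b i)) ^+ 2 = disp.
    rewrite exchange_big; apply: eq_bigr => a _; exact: exchange_big.
  rewrite -/s; field; lra.
have s20 : 0 < s ^+ 2 by rewrite exprn_gt0; lra.
have C0 : 0 < C by lra.
have sC0 : 0 < 2 * (s ^+ 2 * C) by lra.
rewrite mulrBl mul1r lerD2l lerN2 ler_pdivrMl //.
rewrite mulrA; apply: le_trans key _.
rewrite le_eqVlt; apply/orP; left; apply/eqP; move: (C) => c; field.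
by rewrite gt_eqF //; lra.
Qed.

End AbstractGap.

(** * Polynomial representations of SL(n,Z) *)

(** Polynomiality is asked only along the one-parameter elementary subgroups. The action is on row
    vectors, from the right. *)
Definition polyrep n m (rho : 'M[int]_n -> 'M[rat]_m) : Prop :=
  [/\ rho 1%:M = 1%:M, forall a b, rho (a *m b) = rho a *m rho b &
   forall i j, i != j -> exists Q : 'M[{poly rat}]_m,
     forall t : int, rho (elt i j t) = map_mx (horner_eval t%:~R) Q].

Lemma polyrep_std n : polyrep (fun X : 'M[int]_n => map_mx intr X).
Proof.
split; [exact: map_mx1 | exact: map_mxM |].
move=> i j _; exists (1%:M + 'X *: delta_mx i j) => t.
rewrite map_mxD map_mx1 map_mxD map_mx1 !map_mxZ /= !map_delta_mx.
by rewrite /horner_eval hornerX.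
Qed.

Lemma polyrep_tens n m (rho : 'M[int]_n -> 'M[rat]_m) l :
  polyrep rho -> polyrep (fun X => tens l (rho X)).
Proof.
move=> [r1 rM rP]; split; first by rewrite r1 tens1.
  by move=> a b; rewrite rM tensM.
move=> i j /rP [Q hQ]; exists (tens l Q) => t.
by rewrite hQ tens_map.
Qed.

Lemma polyrep_add1 n m k (rho : 'M[int]_n -> 'M[rat]_m) :
  polyrep rho -> polyrep (fun X => block_mx (rho X) 0 0 (1%:M : 'M[_]_k)).
Proof.
move=> [r1 rM rP]; split; first by rewrite r1 -scalar_mx_block.
  by move=> a b; rewrite rM mulmx_block !mulmx0 !mul0mx !addr0 !add0r mulmx1.
move=> i j /rP [Q hQ]; exists (block_mx Q 0 0 1%:M) => t.
by rewrite hQ map_block_mx !raddf0 map_mx1.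
Qed.

Lemma poly_even0 (p : {poly rat}) :
  (forall t : nat, p.[(2 * t%:Z)%:~R] = 0) -> p = 0.
Proof.
move=> h; apply/eqP; apply: contraT => pn0.
have := max_poly_roots pn0 (rs := [seq (2 * t%:Z)%:~R | t <- iota 0 (size p)]).
rewrite size_map size_iota ltnn => ->//.
  by apply/allP=> x /mapP [t _ ->]; apply/eqP/h.
rewrite map_inj_uniq ?iota_uniq // => x y /intr_inj e.
by lia.
Qed.

Lemma polymx_even0 a b (P : 'M[{poly rat}]_(a, b)) :
  (forall t : nat, map_mx (horner_eval (2 * t%:Z)%:~R) P = 0) ->
  P = 0.
Proof.
move=> h; apply/matrixP=> i j; rewrite mxE; apply: poly_even0 => t.
by have /matrixP/(_ i j) := h t; rewrite !mxE.
Qed.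

Section PolyRep.
Variables (n m : nat) (rho : 'M[int]_n -> 'M[rat]_m).
Hypothesis prho : polyrep rho.

Let rho1 : rho 1%:M = 1%:M. Proof. by case: prho. Qed.
Let rhoM a b : rho (a *m b) = rho a *m rho b. Proof. by case: prho. Qed.

Lemma elt_nat i j (t : nat) : i != j ->
  rho (elt i j (2 * t.+1%:Z)) = rho (elt i j (2 * t%:Z)) *m rho (elt i j 2).
Proof. by move=> ij; rewrite -rhoM eltD //; congr (rho (elt _ _ _)); lia. Qed.

(** Both sides are polynomial in [t], and the even naturals are Zariski dense in the line. This
    recovers the full group from the elements with parameter 2. *)
Lemma elt_even0 (a b : nat) (x : 'M[_]_(a, m)) (y : 'M[_]_(m, b)) (z : 'M[_]_(a, b)) i j :
  i != j -> (forall t : nat, x *m rho (elt i j (2 * t%:Z)) *m y = z) ->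
  forall t, x *m rho (elt i j t) *m y = z.
Proof.
move=> ij h t; have [_ _ /(_ i j ij) [Q hQ]] := prho.
pose c p q (M : 'M[rat]_(p, q)) : 'M[{poly rat}]_(p, q) := map_mx polyC M.
have hc p q (M : 'M[rat]_(p, q)) (u : rat) : map_mx (horner_eval u) (c _ _ M) = M.
  by apply/matrixP=> k l; rewrite !mxE /horner_eval hornerC.
have ev (u : int) : map_mx (horner_eval u%:~R) (c _ _ x *m Q *m c _ _ y - c _ _ z)
     = x *m rho (elt i j u) *m y - z.
  by rewrite map_mxB !map_mxM !hc hQ.
have P0 : c _ _ x *m Q *m c _ _ y - c _ _ z = 0.
  by apply: polymx_even0 => s; rewrite ev h subrr.
by apply/eqP; rewrite -subr_eq0 -ev P0 map_mx0.
Qed.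

(** Stability is the vanishing of [A *m rho g *m cokermx A], polynomial along each elementary
    subgroup, so [elt_even0] applies. *)
Lemma stable_elt2 (a : nat) (A : 'M[_]_(a, m)) :
  (forall i j, i != j -> A *m rho (elt i j 2) <= A)%MS ->
  forall g, \det g = 1 -> (A *m rho g <= A)%MS.
Proof.
move=> h g /SL_elementary; elim=> [|{}g i j t ij _ IH].
  by rewrite rho1 mulmx1.
rewrite rhoM mulmxA; apply: submx_trans (submxMr _ IH) _.
rewrite submxE; apply/eqP; move: t; apply: elt_even0 => //.
elim=> [|t IHt].
  by rewrite mulr0 elt0 rho1 mulmx1 mulmx_coker.
apply/eqP; rewrite -submxE elt_nat // mulmxA.
apply: submx_trans (h i j ij).
by apply: submxMr; rewrite submxE; apply/eqP.
Qed.

Lemma fixed_elt2 (a : nat) (x : 'M[_]_(a, m)) :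
  (forall i j, i != j -> x *m rho (elt i j 2) = x) ->
  forall g, \det g = 1 -> x *m rho g = x.
Proof.
move=> h g /SL_elementary; elim=> [|{}g i j t ij _ IH].
  by rewrite rho1 mulmx1.
rewrite rhoM mulmxA IH -[LHS]mulmx1; move: t; apply: elt_even0 => //.
elim=> [|t IHt]; first by rewrite mulr0 elt0 rho1 !mulmx1.
move: IHt; rewrite !mulmx1 => IHt.
by rewrite elt_nat // mulmxA IHt h.
Qed.

End PolyRep.

(** The braid relation makes a homomorphism to a vector space agree on the two unipotents, and the
    Weyl element having fourth power 1 then makes it vanish on them. *)
Lemma elt_braid n (i j : 'I_n) : i != j ->
  elt i j 1 *m elt j i (-1) *m elt i j 1 = elt j i (-1) *m elt i j 1 *m elt j i (-1) /\
  (elt i j 1 *m elt j i (-1) *m elt i j 1) *m (elt i j 1 *m elt j i (-1) *m elt i j 1)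
  *m ((elt i j 1 *m elt j i (-1) *m elt i j 1) *m (elt i j 1 *m elt j i (-1) *m elt i j 1))
  = 1%:M.
Proof.
move=> ij; have ji : j != i by rewrite eq_sym.
pose w : 'M[int]_n := 1%:M - delta_mx i i - delta_mx j j + delta_mx i j - delta_mx j i.
have d0 (a b c d : 'I_n) : b != c -> delta_mx a b *m delta_mx c d = 0 :> 'M[int]_n.
  by move=> bc; rewrite mul_delta_mx_0.
have d1 (a b c : 'I_n) : delta_mx a b *m delta_mx b c = delta_mx a c :> 'M[int]_n.
  by rewrite mul_delta_mx.
have dE := (mulmxDl, mulmxDr, mulmxN, mulNmx, mul1mx, mulmx1).
have e1 : elt i j 1 *m elt j i (-1) *m elt i j 1 = w.
  rewrite /elt scale1r scaleN1r !dE !(d1, d0 _ _ _ _ ij, d0 _ _ _ _ ji, mul0mx).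
  by apply/matrixP=> x y; rewrite !mxE; ring.
have e2 : elt j i (-1) *m elt i j 1 *m elt j i (-1) = w.
  rewrite /elt scale1r scaleN1r !dE !(d1, d0 _ _ _ _ ij, d0 _ _ _ _ ji, mul0mx).
  by apply/matrixP=> x y; rewrite !mxE; ring.
rewrite e1 e2; split=> //.
have w2 : w *m w = 1%:M - delta_mx i i - delta_mx j j - delta_mx i i - delta_mx j j.
  rewrite /w !dE !(d1, d0 _ _ _ _ ij, d0 _ _ _ _ ji, mul0mx).
  by apply/matrixP=> x y; rewrite !mxE; ring.
rewrite w2 !dE !(d1, d0 _ _ _ _ ij, d0 _ _ _ _ ji, mul0mx).
by apply/matrixP=> x y; rewrite !mxE; ring.
Qed.

Section DoubleFix.
Variables (n m : nat) (rho : 'M[int]_n -> 'M[rat]_m).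
Hypothesis prho : polyrep rho.

Let rho1 : rho 1%:M = 1%:M. Proof. by case: prho. Qed.
Let rhoM a b : rho (a *m b) = rho a *m rho b. Proof. by case: prho. Qed.

(* [g |-> x (rho g - 1)] is a homomorphism from SL(n,Z) to the fixed vectors, and the
   abelianization of SL(n,Z) is finite. *)
Lemma fixed_mod_fixed (x : 'rV_m) :
  (forall i j k l, i != j -> k != l ->
    x *m (rho (elt i j 2) - 1%:M) *m (rho (elt k l 2) - 1%:M) = 0) ->
  forall i j, i != j -> x *m rho (elt i j 2) = x.
Proof.
move=> h.
have fix1 i j : i != j -> forall g, \det g = 1 ->
    x *m (rho (elt i j 2) - 1%:M) *m rho g = x *m (rho (elt i j 2) - 1%:M).
  move=> ij; apply: fixed_elt2 => // k l kl.
  by apply/eqP; rewrite -subr_eq0 -[X in _ - X]mulmx1 -mulmxBr h.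
(* For even [t] the displacement of [x] is a multiple of the fixed vector from [fix1]; density gives
   all [t]. *)
have fix2 i j t : i != j -> forall g, \det g = 1 ->
    x *m (rho (elt i j t) - 1%:M) *m rho g = x *m (rho (elt i j t) - 1%:M).
  move=> ij g dg; apply/eqP; rewrite -subr_eq0; apply/eqP.
  have -> : x *m (rho (elt i j t) - 1%:M) *m rho g - x *m (rho (elt i j t) - 1%:M)
     = x *m rho (elt i j t) *m (rho g - 1%:M) - (x *m rho g - x).
    rewrite !mulmxBr !mulmxBl !mulmx1.
    move: (x *m rho (elt i j t) *m rho g) (x *m rho (elt i j t)) (x *m rho g) => p q r.
    by apply/rowP=> k; rewrite !mxE; ring.
  apply/eqP; rewrite subr_eq0; apply/eqP.
  move: t; apply: elt_even0 => // s.
  have -> : x *m rho (elt i j (2 * s%:Z)) = x + s%:R *: (x *m (rho (elt i j 2) - 1%:M)).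
    elim: s => [|s IH]; first by rewrite mulr0 elt0 rho1 mulmx1 scale0r addr0.
    rewrite elt_nat // mulmxA IH mulmxDl -scalemxAl fix1 //; last first.
      exact: elementary_det (elementary_elt _ _).
    have -> : x *m rho (elt i j 2) = x + x *m (rho (elt i j 2) - 1%:M).
      by rewrite mulmxBr mulmx1 addrC subrK.
    by rewrite -[s.+1%:R]natr1 scalerDl scale1r -addrA [_ *: _ + _]addrC.
  by rewrite mulmxDl mulmxBr mulmx1 -scalemxAl mulmxBr mulmx1 fix1 // subrr scaler0 addr0.
move=> i j ij; have ji : j != i by rewrite eq_sym.
pose E := rho (elt i j 1); pose F := rho (elt j i (-1)).
pose a := x *m (E - 1%:M); pose b := x *m (F - 1%:M).
have dE := elementary_det (elementary_elt 1 ij).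
have dF := elementary_det (elementary_elt (-1) ji).
have xE : x *m E = x + a by rewrite /a mulmxBr mulmx1 addrC subrK.
have xF : x *m F = x + b by rewrite /b mulmxBr mulmx1 addrC subrK.
have aE : a *m E = a by apply: fix2.
have aF : a *m F = a by apply: fix2.
have bE : b *m E = b by apply: fix2.
have bF : b *m F = b by apply: fix2.
clearbody a b.
have [br w4] := elt_braid ij.
have xW : x *m rho (elt i j 1 *m elt j i (-1) *m elt i j 1) = x + (a + b + a).
  by rewrite !rhoM !mulmxA -/E -/F !(xE, xF, mulmxDl, aE, aF, bE, bF) -!addrA.
have xW' : x *m rho (elt i j 1 *m elt j i (-1) *m elt i j 1) = x + (b + a + b).
  by rewrite br !rhoM !mulmxA -/E -/F !(xE, xF, mulmxDl, aE, aF, bE, bF) -!addrA.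
have ab : a = b.
  apply/rowP=> k; have /rowP/(_ k) := etrans (esym xW) xW'; rewrite !mxE; lra.
(* The Weyl element translates [x] by [3 a], so its fourth power gives [12 a = 0]. *)
have a0 : a = 0.
  have : x *m rho 1%:M = x by rewrite rho1 mulmx1.
  rewrite -w4.
  have : (a + b + a) *m rho (elt i j 1 *m elt j i (-1) *m elt i j 1) = a + b + a.
    by rewrite !rhoM !mulmxA -/E -/F !(mulmxDl, aE, aF, bE, bF).
  move: (elt i j 1 *m elt j i (-1) *m elt i j 1) xW => W xW cW.
  have step y : y *m rho W = y + (a + b + a) ->
      (y + (a + b + a)) *m rho W = y + (a + b + a) + (a + b + a).
    by move=> e; rewrite mulmxDl e cW.
  have s2 := step _ xW; have s3 := step _ s2.
  rewrite !rhoM !mulmxA xW s2 s3 (step _ s3) -ab => /rowP e.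
  by apply/rowP=> k; have := e k; rewrite !mxE; lra.
have xEx : x *m E = x by rewrite xE a0 addr0.
by rewrite -[2]/(1 + 1) -eltD // rhoM mulmxA -/E !xEx.
Qed.

End DoubleFix.

(** * Spectral gap on the lines of a representation *)

Section Lines.
Variables (F : fieldType) (m : nat).
Implicit Types x : 'rV[F]_m.

(** A canonical vector on the line of [x]: [pick] depends only on the support, which scaling
    preserves. *)
Definition lnorm x : 'rV[F]_m :=
  if [pick i | x 0 i != 0] is Some i then (x 0 i)^-1 *: x else x.

Lemma lnormZ c x : c != 0 -> lnorm (c *: x) = lnorm x.
Proof.
move=> c0; rewrite /lnorm.
rewrite (@eq_pick _ _ (fun i => x 0 i != 0)) => [|i]; last by rewrite mxE mulf_eq0 (negbTE c0).
case: pickP => [i xi|none]; first by rewrite mxE invfM scalerA mulrAC mulVf // mul1r.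
suff -> : x = 0 by rewrite scaler0.
by apply/rowP=> i; rewrite mxE; apply/eqP; rewrite -[_ == _]negbK none.
Qed.

Lemma lnormE x : exists2 c, c != 0 & lnorm x = c *: x.
Proof.
rewrite /lnorm; case: pickP => [i xi|_]; first by exists (x 0 i)^-1; rewrite ?invr_eq0.
by exists 1; rewrite ?oner_eq0 ?scale1r.
Qed.

Lemma lnorm_id x : lnorm (lnorm x) = lnorm x.
Proof. by have [c c0 {1}->] := lnormE x; rewrite lnormZ. Qed.

Lemma lnormM x (g : 'M[_]_m) : lnorm (lnorm x *m g) = lnorm (x *m g).
Proof. by have [c c0 ->] := lnormE x; rewrite -scalemxAl lnormZ. Qed.

End Lines.

(** By duality, the column space of [C] lies in the sum of those of the [B k]. This turns a
    statement about kernels into an identity from which explicit bounds follow. *)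
Lemma ker_family (F : fieldType) (I : finType) m b c (B : I -> 'M[F]_(m, b)) (C : 'M[_]_(m, c)) :
  (forall x : 'rV_m, (forall k, x *m B k = 0) -> x *m C = 0) ->
  exists R : I -> 'M[_]_(b, c), C = \sum_k B k *m R k.
Proof.
move=> h.
have : (C^T <= \sum_k <<(B k)^T>>)%MS.
  rewrite submxE; set Y := cokermx _; rewrite -trmx_eq0 trmx_mul trmxK.
  apply/eqP/row_matrixP=> i; rewrite row_mul row0; apply: h => k.
  rewrite -row_mul; suff -> : Y^T *m B k = 0 by rewrite row0.
  apply: trmx_inj; rewrite trmx_mul trmxK trmx0; apply/eqP; rewrite -submxE.
  by rewrite (submx_trans _ (sumsmx_sup k _ (submx_refl _))) // genmxE.
case/sub_sumsmxP=> u eC.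
have ex k : exists R : 'M[_]_(b, c), (u k *m <<(B k)^T>>)%MS = (B k *m R)^T.
  have /submxP [D eD] : (u k *m <<(B k)^T>> <= (B k)^T)%MS.
    by rewrite (submx_trans (submxMl _ _)) // genmxE.
  by exists D^T; rewrite eD trmx_mul trmxK.
have [R hR] := fin_all_exists ex.
exists R; apply: trmx_inj; rewrite eC linear_sum /=.
by apply: eq_bigr => k _; rewrite hR.
Qed.

Lemma count_exists (I : finType) (T : Type) (P : I -> pred T) (s : seq T) :
  (count (fun t => [exists q, P q t]) s <= \sum_q count (P q) s)%N.
Proof.
rewrite -sum1_count big_mkcond /=.
under [leqRHS]eq_bigr do rewrite -sum1_count big_mkcond /=.
rewrite exchange_big /=; apply: leq_sum => t _.
by case: existsP => // -[q Pq]; rewrite (bigD1 q) //= Pq.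
Qed.

(** * Expectations over the first [k] steps, as finite averages *)

Section Expectation.
Variables (K : realFieldType) (n : nat) (S : seq 'M[int]_n).

Fixpoint expect (k : nat) (phi : 'M[int]_n -> K) : K :=
  if k is k'.+1 then (size S)%:R^-1 * \sum_(a <- S) expect k' (fun X => phi (X *m a))
  else phi 1%:M.

Hypothesis SSL : forall s, s \in S -> \det s = 1.

Lemma expect_ext k (phi psi : 'M[int]_n -> K) :
  (forall X, \det X = 1 -> phi X = psi X) -> expect k phi = expect k psi.
Proof.
elim: k phi psi => [|k IH] phi psi h /=; first by rewrite h ?det1.
congr (_ * _); apply: eq_big_seq => a aS; apply: IH => X dX.
by apply: h; rewrite det_mulmx dX SSL ?mulr1.
Qed.

Lemma expect_le k (phi psi : 'M[int]_n -> K) :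
  (forall X, \det X = 1 -> phi X <= psi X) -> expect k phi <= expect k psi.
Proof.
elim: k phi psi => [|k IH] phi psi h /=; first by rewrite h ?det1.
rewrite ler_wpM2l ?invr_ge0 ?ler0n // !big_seq; apply: ler_sum => a aS; apply: IH => X dX.
by apply: h; rewrite det_mulmx dX SSL ?mulr1.
Qed.

Lemma expectZ k c (phi : 'M[int]_n -> K) : expect k (fun X => c * phi X) = c * expect k phi.
Proof.
elim: k phi => [//|k IH] phi /=; rewrite mulrCA; congr (_ * _).
by rewrite mulr_sumr; apply: eq_bigr => a _; rewrite IH.
Qed.

Lemma expect_sum k (T : Type) (r : seq T) (phi : T -> 'M[int]_n -> K) :
  expect k (fun X => \sum_(t <- r) phi t X) = \sum_(t <- r) expect k (phi t).
Proof.
elim: k phi => [//|k IH] phi /=.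
rewrite -mulr_sumr exchange_big; congr (_ * _).
by apply: eq_bigr => a _; rewrite (IH (fun t X => phi t (X *m a))).
Qed.

Lemma expectD k (phi psi : 'M[int]_n -> K) :
  expect k (fun X => phi X + psi X) = expect k phi + expect k psi.
Proof.
elim: k phi psi => [//|k IH] phi psi /=; rewrite -mulrDr -big_split.
by congr (_ * _); apply: eq_bigr => a _; rewrite IH.
Qed.

Lemma expect_cst k c : (0 < size S)%N -> expect k (fun=> c) = c.
Proof.
move=> S0; elim: k => [//|k IH] /=.
rewrite (eq_bigr (fun=> c)) // big_const_seq count_predT iter_addr addr0.
by rewrite -[c *+ _]mulr_natl mulKf // pnatr_eq0 -lt0n.
Qed.

Lemma expect_ge0 k (phi : 'M[int]_n -> K) :
  (forall X, \det X = 1 -> 0 <= phi X) -> 0 <= expect k phi.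
Proof.
elim: k phi => [|k IH] phi h /=; first by rewrite h ?det1.
rewrite mulr_ge0 ?invr_ge0 ?ler0n // big_seq; apply: sumr_ge0 => a aS; apply: IH => X dX.
by apply: h; rewrite det_mulmx dX SSL ?mulr1.
Qed.

End Expectation.

Section ConcreteGap.
Variables (K : realFieldType) (n : nat) (S : seq 'M[int]_n).
Hypotheses (Suniq : uniq S) (SSL : forall s, s \in S -> \det s = 1)
  (Ssym : forall s, s \in S -> invmx s \in S)
  (Sgen : generates_SL S)
  (S0 : (0 < size S)%N).
Variables (m : nat) (rho : 'M[int]_n -> 'M[rat]_m).
Hypothesis prho : polyrep rho.

Let rho1 : rho 1%:M = 1%:M. Proof. by case: prho. Qed.
Let rhoM a b : rho (a *m b) = rho a *m rho b. Proof. by case: prho. Qed.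

Lemma unit_det1 (g : 'M[int]_n) : \det g = 1 -> g \in unitmx.
Proof. by move=> dg; rewrite unitmxE dg unitr1. Qed.

Lemma det_invmx1 (g : 'M[int]_n) : \det g = 1 -> \det (invmx g) = 1.
Proof. by move=> dg; rewrite det_inv dg invr1. Qed.

Lemma rhoK (g : 'M[int]_n) : \det g = 1 -> rho g *m rho (invmx g) = 1%:M.
Proof. by move=> dg; rewrite -rhoM mulmxV ?unit_det1. Qed.

Lemma rhoVK (g : 'M[int]_n) : \det g = 1 -> rho (invmx g) *m rho g = 1%:M.
Proof. by move=> dg; rewrite -rhoM mulVmx ?unit_det1. Qed.

Let E := ('I_n * 'I_n)%type.
Definition elt2 (e : 'I_n * 'I_n) : 'M[int]_n :=
  if e.1 == e.2 then 1%:M else elt e.1 e.2 2.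
Let U e := rho (elt2 e).

Lemma det_elt2 e : \det (elt2 e) = 1.
Proof.
rewrite /elt2; case: eqVneq => [_|ne]; first exact: det1.
exact/elementary_det/elementary_elt.
Qed.

Definition nonfixed (x : 'rV[rat]_m) := [exists e, x *m U e != x].

Lemma nonfixedP x : reflect (exists2 g, \det g = 1 & x *m rho g != x) (nonfixed x).
Proof.
apply: (iffP existsP) => [[e xe]|[g dg xg]]; first by exists (elt2 e); rewrite ?det_elt2.
apply/existsP; apply: contraNT xg => /existsPn h; apply/eqP; apply: fixed_elt2 dg => //.
move=> i j ij; apply/eqP; rewrite -[_ == _]negbK.
by have := h (i, j); rewrite /U /elt2 /= (negbTE ij).
Qed.

Lemma nonfixedM x g : \det g = 1 -> nonfixed x -> nonfixed (x *m rho g).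
Proof.
move=> dg /nonfixedP [h dh xh]; apply/nonfixedP.
exists (invmx g *m h *m g); first by rewrite !det_mulmx det_invmx1 // dh dg !mulr1.
apply: contraNneq xh; rewrite !rhoM !mulmxA -[x *m rho g *m _]mulmxA rhoK // mulmx1.
by move/(congr1 (mulmx^~ (rho (invmx g)))); rewrite -!mulmxA rhoK // !mulmx1 => ->.
Qed.

Lemma nonfixedZ c x : c != 0 -> nonfixed (c *: x) = nonfixed x.
Proof.
move=> c0; apply: eq_existsb => e; rewrite -scalemxAl.
by rewrite (inj_eq (can_inj (scalerK c0))).
Qed.

Lemma nonfixed_lnorm x : nonfixed (lnorm x) = nonfixed x.
Proof. by have [c c0 ->] := lnormE x; rewrite nonfixedZ. Qed.

(** Lines are encoded by normalised vectors. Fixed vectors must be excluded, since a point mass on a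
    fixed line is invariant. *)
Definition Line := {x : 'rV[rat]_m | (lnorm x == x) && nonfixed x}.

Definition sg (a : 'M[int]_n) (x : Line) : Line := insubd x (lnorm (val x *m rho a)).

Lemma sgE a x : \det a = 1 -> val (sg a x) = lnorm (val x *m rho a).
Proof.
move=> da; rewrite /sg insubdK // unfold_in lnorm_id eqxx nonfixed_lnorm nonfixedM //.
by case/andP: (valP x).
Qed.

Lemma sgK a : \det a = 1 -> cancel (sg a) (sg (invmx a)).
Proof.
move=> da x; apply: val_inj; rewrite sgE ?det_invmx1 // sgE // lnormM.
by rewrite -mulmxA rhoK // mulmx1; case/andP: (valP x) => /eqP.
Qed.

Lemma sgVK a : \det a = 1 -> cancel (sg (invmx a)) (sg a).
Proof.
move=> da x; apply: val_inj; rewrite sgE // sgE ?det_invmx1 // lnormM.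
by rewrite -mulmxA rhoVK // mulmx1; case/andP: (valP x) => /eqP.
Qed.

Lemma sg_inv a : a \in S ->
  exists2 b, b \in S & cancel (sg a) (sg b) /\ cancel (sg b) (sg a).
Proof.
by move=> aS; exists (invmx a); [exact: Ssym | split; [apply: sgK | apply: sgVK]; apply: SSL].
Qed.

Lemma actwE w (x : Line) : all (mem S) w ->
  val (actw sg w x) = lnorm (val x *m rho (foldr (fun a b => a *m b) 1%:M w)).
Proof.
elim: w x => [|a w IH] x /=.
  by rewrite rho1 mulmx1; case/andP: (valP x) => /eqP.
move=> /andP [aS wS]; rewrite IH // sgE ?SSL // lnormM.
by rewrite -mulmxA -rhoM.
Qed.

(* [far d e x]: the unipotent [U e] moves the class of [x] modulo the fixed vectors
   by at least a proportion [d]; that class is read off from the vectors [x (U e' - 1)]. *)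
Definition far (d : rat) (e : E) (x : 'rV[rat]_m) : bool :=
  [exists q : E * 'I_m,
    let y := (x *m (U e - 1%:M) *m (U q.1 - 1%:M)) 0 q.2 in
    (y != 0) && [forall p : E * 'I_m, d * `|(x *m (U p.1 - 1%:M)) 0 p.2| <= `|y|]].

Lemma farZ d e c x : c != 0 -> far d e (c *: x) = far d e x.
Proof.
move=> c0; apply: eq_existsb => q /=; rewrite -!scalemxAl mxE mulf_eq0 negb_or c0 /=.
congr (_ && _); apply: eq_forallb => p; rewrite -!scalemxAl mxE !normrM mulrCA.
by rewrite ler_pM2l // normr_gt0.
Qed.

(** By [fixed_mod_fixed] and [ker_family], each [U e - 1] is a combination of products of two such
    differences. If no [e] were far, the largest first difference would be bounded by a proper
    fraction of itself. *)
Lemma far_cover : exists2 d : rat, 0 < d & forall x, nonfixed x -> exists e, far d e x.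
Proof.
have ex (e0 : E) : exists R : E * E -> 'M[rat]_m,
    U e0 - 1%:M = \sum_p (U p.1 - 1%:M) *m (U p.2 - 1%:M) *m R p.
  apply: ker_family => x h.
  have fx := @fixed_mod_fixed n m rho prho x.
  apply/eqP; rewrite mulmxBr mulmx1 subr_eq0 /U /elt2; case: (eqVneq e0.1 e0.2) => [_|ne].
    by rewrite rho1 mulmx1.
  apply/eqP/fx => // i j k l ij kl; have := h ((i, j), (k, l)).
  by rewrite /U /elt2 /= (negbTE ij) (negbTE kl) mulmxA.
have [R hR] := fin_all_exists ex.
(* The total of the coefficients plus 1, so that the resulting factor [(C - 1) / C] is below 1. *)
pose C := \sum_e \sum_p \sum_k \sum_l `|R e p k l| + 1.
have C1 : 1 <= C.
  by rewrite lerDr; do 4![apply: sumr_ge0 => ? _].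
have C0 : 0 < C by lra.
exists C^-1; first by rewrite invr_gt0.
move=> x /existsP [e1 xe1].
pose v (p : E * 'I_m) := `|(x *m (U p.1 - 1%:M)) 0 p.2|.
have [p0 v0] : exists p, 0 < v p.
  have : x *m (U e1 - 1%:M) != 0 by rewrite mulmxBr mulmx1 subr_eq0.
  case/rV0Pn=> c hc; exists (e1, c); by rewrite normr_gt0.
pose pm := [arg max_(p > p0 | true) v p]%O.
have vm p : v p <= v pm.
  by rewrite /pm; case: Order.TotalTheory.arg_maxP => //= i _; apply.
have vm0 : 0 < v pm by apply: lt_le_trans v0 (vm _).
apply/existsP; apply: contraTT isT => /existsPn nofar.
have small e q : `|(x *m (U e - 1%:M) *m (U q.1 - 1%:M)) 0 q.2| <= C^-1 * v pm.
  have := nofar e => /existsPn/(_ q) /=; rewrite negb_and negbK => /orP [/eqP ->|].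
    by rewrite normr0 mulr_ge0 // ?invr_ge0 ltW.
  case/forallPn=> p; rewrite -ltNge => /ltW h; apply: le_trans h _.
  by apply: ler_wpM2l; [rewrite invr_ge0 ltW | apply: vm].
have : v pm <= C^-1 * v pm * (C - 1).
  rewrite {1}/v hR mulmx_sumr summxE; apply: le_trans (ler_norm_sum _ _ _) _.
  apply: le_trans (_ : \sum_p \sum_k C^-1 * v pm * `|R pm.1 p k pm.2| <= _).
    apply: ler_sum => p _; rewrite !mulmxA mxE; apply: le_trans (ler_norm_sum _ _ _) _.
    apply: ler_sum => k _; rewrite normrM ler_wpM2r //.
    exact: (small p.1 (p.2, k)).
  have -> : C - 1 = \sum_e \sum_p \sum_k \sum_l `|R e p k l| by rewrite /C addrK.
  have CV0 : 0 <= C^-1 * v pm by rewrite mulr_ge0 // ?invr_ge0 ltW.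
  under eq_bigr do rewrite -mulr_sumr.
  rewrite -mulr_sumr ler_wpM2l // (bigD1 pm.1) //= ler_wpDr //.
    by do 4![apply: sumr_ge0 => ? _].
  apply: ler_sum => p _; apply: ler_sum => k _; rewrite (bigD1 pm.2) //= lerDl.
  by apply: sumr_ge0.
have -> : C^-1 * v pm * (C - 1) = v pm - C^-1 * v pm by field; rewrite gt_eqF.
have : 0 < C^-1 * v pm by rewrite mulr_gt0 ?invr_gt0.
by lra.
Qed.

(** Writing [elt i j 2] as the square of [elt i j 1] doubles a word; this parity is why parameter 2
    is used throughout. *)
Lemma even_word e : exists w : seq 'M[int]_n,
  [/\ all (mem S) w, ~~ odd (size w) & foldr (fun a b => a *m b) 1%:M w = elt2 e].
Proof.
rewrite /elt2; case: eqVneq => [_|ne]; first by exists [::].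
have [w [wS ew]] := Sgen (elementary_det (elementary_elt 1 ne)).
exists (w ++ w); split.
- by rewrite all_cat wS.
- by rewrite size_cat addnn odd_double.
have cat (u v : seq 'M[int]_n) : foldr (fun a b => a *m b) 1%:M (u ++ v) =
   foldr (fun a b => a *m b) 1%:M u *m foldr (fun a b => a *m b) 1%:M v.
  by elim: u => [|a u IH] /=; rewrite ?mul1mx // IH mulmxA.
by rewrite cat -ew eltD.
Qed.

(** Along an orbit of [U e] the coordinates of the first differences are polynomials in [t] whose
    degree is bounded independently of [x]; being far forces one of them to jump. *)
Lemma far_visits d (W : E -> seq 'M[int]_n) : 0 < d ->
  (forall e, all (mem S) (W e)) ->
  (forall e, foldr (fun a b => a *m b) 1%:M (W e) = elt2 e) ->
  exists k : nat, forall e (x : Line) N,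
    (count (fun t => far d e (val (iter t (actw sg (W e)) x))) (iota 0 N) <= k)%N.
Proof.
move=> d0 WS We.
have exQ (e : E) : exists Q : 'M[{poly rat}]_m, e.1 != e.2 ->
    forall t : int, rho (elt e.1 e.2 t) = map_mx (horner_eval t%:~R) Q.
  have [->|ne] := eqVneq e.1 e.2; first by exists 0.
  by have [_ _ /(_ _ _ ne) [Q hQ]] := prho; exists Q.
have [Q hQ] := fin_all_exists exQ.
pose P e e' : 'M[{poly rat}]_m := Q e *m map_mx polyC (U e' - 1%:M).
pose sz (u : E * E * 'I_m * 'I_m) :=
  size ((P u.1.1.1 u.1.1.2 u.1.2 u.2) \Po (2 *: 'X)).
pose D := (\max_u sz u)%N.
have [k0 hk0] := count_jumps D d0.
exists (#|{: E * 'I_m}| * k0)%N => e x N.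
have [ee|ne] := eqVneq e.1 e.2.
  rewrite (@eq_count _ _ pred0) ?count_pred0 // => t; apply: negbTE; apply/negP=> /existsP [q] /=.
  by rewrite {1}/U /elt2 ee eqxx rho1 subrr mulmx0 mul0mx mxE eqxx.
pose p (q : E * 'I_m) : {poly rat} := \sum_k (val x) 0 k *: (P e q.1 k q.2 \Po (2 *: 'X)).
have sp q : (size (p q) <= D)%N.
  apply: leq_trans (size_sum _ _ _) _; apply/bigmax_leqP => k _.
  apply: leq_trans (size_scale_leq _ _) _.
  exact: (leq_bigmax (e, q.1, k, q.2)).
have pE q (t : nat) : (p q).[t%:R] =
    (val x *m rho (elt e.1 e.2 (2 * t%:Z)) *m (U q.1 - 1%:M)) 0 q.2.
  rewrite /p horner_sum -mulmxA [RHS]mxE; apply: eq_bigr => k _.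
  rewrite hornerZ; congr (_ * _).
  rewrite horner_comp hornerZ hornerX hQ //.
  have -> : (2 * t%:R : rat) = (2 * t%:Z)%:~R by rewrite intrM.
  rewrite /P !mxE horner_sum; apply: eq_bigr => l _.
  by rewrite hornerM !mxE hornerC.
have vE t : val (iter t (actw sg (W e)) x) = lnorm (val x *m rho (elt e.1 e.2 (2 * t%:Z))).
  elim: t => [|t IH].
    by rewrite mulr0 elt0 rho1 mulmx1; case/andP: (valP x) => /eqP.
  rewrite iterS actwE // IH lnormM We /elt2 (negbTE ne) -mulmxA -elt_nat //.
apply: leq_trans (_ : count (fun t => [exists q, jump d (p q) t]) (iota 0 N) <= _)%N.
  apply: sub_count => t /=; rewrite vE.
  have [c c0 ->] := lnormE (val x *m rho (elt e.1 e.2 (2 * t%:Z))).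
  rewrite farZ // => /existsP [q] /= /andP [y0 /forallP/(_ q) yq].
  apply/existsP; exists q; rewrite /jump.
  have -> : (p q).[t.+1%:R] = (p q).[t%:R] + (val x *m rho (elt e.1 e.2 (2 * t%:Z)) *m
      (U e - 1%:M) *m (U q.1 - 1%:M)) 0 q.2.
    rewrite !pE elt_nat // mulmxA; set z := val x *m _.
    have -> : rho (elt e.1 e.2 2) = U e by rewrite /U /elt2 (negbTE ne).
    have -> : z *m U e *m (U q.1 - 1%:M) = z *m (U q.1 - 1%:M) +
        z *m (U e - 1%:M) *m (U q.1 - 1%:M).
      by rewrite (mulmxBr z (U e)) mulmx1 mulmxBl [RHS]addrC subrK.
    by rewrite [LHS]mxE.
  by rewrite -subr_eq0 addrAC subrr add0r y0 pE.
apply: leq_trans (count_exists _ _) _.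
rewrite -sum_nat_const; apply: leq_sum => q _; exact: hk0.
Qed.

Lemma expect_succ_inv k (phi : 'M[int]_n -> 'M[int]_n -> K) :
  \sum_(a <- S) expect S k (fun X => phi X (invmx a)) = \sum_(a <- S) expect S k (fun X => phi X a).
Proof.
rewrite -(big_map (@invmx _ n) predT (fun a => expect S k (fun X => phi X a))).
apply: perm_big; apply: uniq_perm => //.
  rewrite map_inj_in_uniq // => a b aS bS /(congr1 (@invmx _ n)).
  by rewrite !invmxK.
move=> a; apply/mapP/idP => [[b bS ->]|aS]; first exact: Ssym.
by exists (invmx a); rewrite ?invmxK ?Ssym.
Qed.

(** The probability that two independent walks carry [w] to the same line is the squared norm of the
    law [theta N] on lines, and each step contracts that norm. *)
Lemma line_gap : exists r : K, [/\ 0 <= r, r < 1 &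
  forall w : 'rV[rat]_m, (exists2 g, \det g = 1 & w *m rho g != w) ->
  forall N, expect S N (fun X => expect S N (fun Y =>
     (lnorm (w *m rho X) == lnorm (w *m rho Y))%:R)) <= r ^+ N].
Proof.
have [d d0 cov] := far_cover.
have [W hW] := fin_all_exists even_word.
have WS e : all (mem S) (W e) by case: (hW e).
have We e : ~~ odd (size (W e)) by case: (hW e).
have Wu e : foldr (fun a b => a *m b) 1%:M (W e) = elt2 e by case: (hW e).
have [k visits] := far_visits d0 WS Wu.
have [|r [r0 r1 gap]] := @abstract_gap K Line _ S sg sg_inv _ W
    (fun e x => far d e (val x)) k S0 WS We visits.
  by move=> x; apply: cov; case/andP: (valP x).
exists r; split=> // w /nonfixedP nw N.
have pw0 : (lnorm (lnorm w) == lnorm w) && nonfixed (lnorm w).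
  by rewrite lnorm_id eqxx nonfixed_lnorm.
pose w0 : Line := Sub (lnorm w) pw0.
pose key X : Line := insubd w0 (lnorm (w *m rho X)).
have keyE X : \det X = 1 -> val (key X) = lnorm (w *m rho X).
  by move=> dX; rewrite insubdK // unfold_in lnorm_id eqxx nonfixed_lnorm nonfixedM.
have keyM X a : \det X = 1 -> \det a = 1 -> key (X *m a) = sg a (key X).
  move=> dX da; apply: val_inj.
  by rewrite keyE ?det_mulmx ?dX ?da // sgE // keyE // lnormM rhoM mulmxA.
clearbody key.
pose theta j x : K := expect S j (fun X => (key X == x)%:R).
have thetaS j x : theta j.+1 x = avg S sg (theta j) x.
  rewrite /theta /avg /=; congr (_ * _).
  (* The new mass at [x] comes from its preimages; the symmetry of [S] rewrites these as images, as
     in [avg]. *)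
  rewrite -(expect_succ_inv j (fun X a => (key X == sg a x)%:R)).
  apply: eq_big_seq => a aS; apply: expect_ext => // X dX.
  rewrite keyM ?(SSL aS) //.
  suff -> : (sg a (key X) == x) = (key X == sg (invmx a) x) by [].
  apply/eqP/eqP => [<-|->]; first by rewrite sgK ?SSL.
  by rewrite sgVK ?SSL.
have decay i : exists D, [/\ uniq D, forall x, theta i x != 0 -> x \in D &
    \sum_(x <- D) theta i x ^+ 2 <= r ^+ i].
  elim: i => [|i [D0 [u0 s0 b0]]].
    exists [:: key 1%:M]; split=> //.
      move=> x; rewrite /theta /= inE [x == _]eq_sym.
      by case: (key 1%:M == x) => //=; rewrite eqxx.
    by rewrite big_seq1 /theta /= eqxx expr1n.
  have [D [uD s1 s2 b1]] := gap _ _ s0.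
  exists D; split=> //; first by move=> x; rewrite thetaS; apply: s2.
  under eq_bigr do rewrite thetaS.
  apply: le_trans b1 _; rewrite exprS ler_wpM2l //.
  rewrite (@sum_supp_eq _ _ D D0) // => x; rewrite sqrf_eq0; [exact: s1 | exact: s0].
have [D [uD sD bD]] := decay N; apply: le_trans bD.
rewrite le_eqVlt; apply/orP; left; apply/eqP.
transitivity (expect S N (fun X => \sum_(x <- D) (key X == x)%:R * theta N x)).
  apply: expect_ext => // X dX.
  transitivity (theta N (key X)).
    apply: expect_ext => // Y dY; rewrite -!keyE // (inj_eq val_inj).
    by rewrite eq_sym.
  have [kD|kD] := boolP (key X \in D).
    rewrite (bigD1_seq _ kD uD) /= eqxx mul1r big1 ?addr0 // => x.
    by rewrite eq_sym => /negbTE ->; rewrite mul0r.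
  rewrite big_seq big1 => [|x xD].
    by apply/eqP; apply: contraNT kD; apply: sD.
  by case: eqP => [e|_]; [rewrite -e (negbTE kD) in xD | rewrite mul0r].
rewrite expect_sum; apply: eq_bigr => x _; rewrite expr2 -[RHS]expectZ.
by apply: expect_ext => // X _; rewrite mulrC.
Qed.

End ConcreteGap.

(** * Hitting subspaces *)

Section ExMore.
Variables (K : realFieldType) (n : nat) (S : seq 'M[int]_n).
Hypotheses (Suniq : uniq S) (SSL : forall s, s \in S -> \det s = 1)
  (Ssym : forall s, s \in S -> invmx s \in S) (S0 : (0 < size S)%N).

Lemma expect_add j k (phi : 'M[int]_n -> K) :
  expect S (j + k) phi = expect S j (fun Y => expect S k (fun B => phi (Y *m B))).
Proof.
elim: k phi => [|k IH] phi.
  by rewrite addn0; apply: expect_ext => // Y _ /=; rewrite mulmx1.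
rewrite addnS /= expectZ expect_sum; congr (_ * _).
apply: eq_bigr => a _; rewrite IH; apply: expect_ext => // Y _.
by apply: expect_ext => // B _; rewrite mulmxA.
Qed.

Lemma expect_swap j k (psi : 'M[int]_n -> 'M[int]_n -> K) :
  expect S j (fun Y => expect S k (psi Y)) = expect S k (fun B => expect S j (psi^~ B)).
Proof.
elim: k psi => [//|k IH] psi /=.
rewrite expectZ expect_sum; congr (_ * _); apply: eq_bigr => a _.
by rewrite (IH (fun Y B => psi Y (B *m a))).
Qed.

Lemma expect_inv k (phi : 'M[int]_n -> K) : expect S k (fun X => phi (invmx X)) = expect S k phi.
Proof.
elim: k phi => [|k IH] phi; first by rewrite /= invmx1.
rewrite -[in RHS]add1n expect_add /=; congr (_ * _).
rewrite -[RHS](expect_succ_inv Suniq Ssym k (fun X a => phi (1%:M *m a *m X))).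
apply: eq_big_seq => a aS.
rewrite -(IH (fun X => phi (1%:M *m invmx a *m X))); apply: expect_ext => // X dX.
congr phi; rewrite mul1mx; have uX := unit_det1 dX; have ua := unit_det1 (SSL aS).
have uXa : X *m a \in unitmx by rewrite unitmx_mul uX.
apply: (can_inj (mulKmx uXa)).
by rewrite /= mulmxV // mulmxA -[X *m a *m _]mulmxA mulmxV // mulmx1 mulmxV.
Qed.

Lemma expect_sqr k (phi : 'M[int]_n -> K) :
  expect S k phi ^+ 2 <= expect S k (fun X => phi X ^+ 2).
Proof.
set c := expect S k phi.
have : 0 <= expect S k (fun X => (phi X - c) ^+ 2).
  by apply: expect_ge0 => // X _; apply: sqr_ge0.
have -> : expect S k (fun X => (phi X - c) ^+ 2) =
   expect S k (fun X => phi X ^+ 2 + ((- 2 * c) * phi X + c ^+ 2)).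
  by apply: expect_ext => // X _; ring.
by rewrite !expectD expectZ expect_cst // -/c; lra.
Qed.

Lemma expect_sqrE k (phi : 'M[int]_n -> K) :
  expect S k phi ^+ 2 = expect S k (fun B => expect S k (fun B' => phi B * phi B')).
Proof.
rewrite expr2 -expectZ; apply: expect_ext => // B _.
by rewrite expectZ mulrC.
Qed.

End ExMore.

Lemma row_base_ex (F : fieldType) m (L : 'M[F]_m) k : \rank L = k ->
  exists2 A : 'M[F]_(k, m), row_free A & (A :=: L)%MS.
Proof. by move=> <-; exists (row_base L); [exact: row_base_free | exact: eq_row_base]. Qed.

Section HitDecay.
Variables (K : rcfType) (n : nat) (S : seq 'M[int]_n).
Hypotheses (Suniq : uniq S) (SSL : forall s, s \in S -> \det s = 1)
  (Ssym : forall s, s \in S -> invmx s \in S)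
  (Sgen : generates_SL S)
  (S0 : (0 < size S)%N).
Variables (m : nat) (rho : 'M[int]_n -> 'M[rat]_m) (v : 'rV[rat]_m).
Hypothesis prho : polyrep rho.

Let rho1 : rho 1%:M = 1%:M. Proof. by case: prho. Qed.
Let rhoM a b : rho (a *m b) = rho a *m rho b. Proof. by case: prho. Qed.

Definition hit (L : 'M[rat]_m) (X : 'M[int]_n) : bool := (v *m rho X <= L)%MS.
Definition avoidable (L : 'M[rat]_m) := exists2 g, \det g = 1 & ~~ hit L g.

Lemma rho_unit g : \det g = 1 -> rho g \in unitmx.
Proof. by move=> dg; have := rhoK prho dg => /mulmx1_unit []. Qed.

Lemma hitM L Y B : \det B = 1 -> hit L (Y *m B) = hit (L *m rho (invmx B)) Y.
Proof.
move=> dB; rewrite /hit rhoM mulmxA; apply/idP/idP => h.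
  by have := submxMr (rho (invmx B)) h; rewrite -[_ *m rho B *m _]mulmxA (rhoK prho dB) mulmx1.
by have := submxMr (rho B) h; rewrite -[L *m _ *m _]mulmxA (rhoVK prho dB) mulmx1.
Qed.

Lemma avoidable_translate L B : \det B = 1 -> avoidable L -> avoidable (L *m rho (invmx B)).
Proof.
move=> dB [g dg hg]; exists (g *m invmx B); first by rewrite det_mulmx dg det_invmx1 ?mulr1.
by rewrite -hitM // -mulmxA mulVmx ?unit_det1 // mulmx1.
Qed.

Lemma rank_translate (L : 'M[rat]_m) B : \det B = 1 -> \rank (L *m rho (invmx B)) = \rank L.
Proof. by move=> dB; rewrite mxrankMfree // row_free_unit rho_unit // det_invmx1. Qed.

(** Condition on the last [k] steps: they only replace [L] by a translate, over which the bound is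
    uniform. *)
Lemma expect_hit_translate (L : 'M[rat]_m) j k (c : K) :
  (forall B, \det B = 1 -> expect S j (fun X => (hit (L *m rho (invmx B)) X)%:R) <= c) ->
  expect S (j + k) (fun X => (hit L X)%:R) <= c.
Proof.
move=> h; rewrite expect_add // expect_swap.
rewrite -[leRHS](expect_cst k c S0); apply: expect_le => // B dB.
apply: le_trans (h B dB); rewrite le_eqVlt; apply/orP; left; apply/eqP.
by apply: expect_ext => // Y dY; rewrite hitM.
Qed.

(** Each unit of rank spends [j] further steps on making translates of [L] differ, whence the time
    [l * j]. The second moment argument costs a square root of the rate. *)
Lemma hit_decay_rank (l : nat) : exists C r : K, [/\ 0 <= C, 0 <= r, r < 1 &
  forall L : 'M[rat]_m, (\rank L <= l)%N -> avoidable L ->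
  forall j, expect S (l * j) (fun X => (hit L X)%:R) <= C * r ^+ j].
Proof.
elim: l => [|l [C [r [C0 r0 r1 IH]]]].
  exists 0, 0; split=> // L; rewrite leqn0 mxrank_eq0 => /eqP -> [g dg].
  rewrite /hit submx0 => vg j; rewrite mul0r mul0n /=.
  rewrite rho1 mulmx1 submx0; case: eqP => // v0.
  by rewrite v0 mul0mx eqxx in vg.
have [r' [r'0 r'1 gap]] := @line_gap K n S Suniq SSL Ssym Sgen S0 _ _ (polyrep_tens l.+1 prho).
pose q := Num.max r r'.
have q0 : 0 <= q by rewrite le_max r0.
have q1 : q < 1 by rewrite gt_max r1.
have sq1 : Num.sqrt q < 1 by rewrite -[1]sqrtr1 ltr_sqrt.
have qq : q <= Num.sqrt q.
  by rewrite -{1}[q]sqr_sqrtr // expr2 ler_piMl ?sqrtr_ge0 // ltW.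
exists (1 + C), (Num.sqrt q); split; [lra | exact: sqrtr_ge0 | exact: sq1 |].
have C1 : 0 <= 1 + C by lra.
move=> L rkL pL j; rewrite mulSn addnC.
move: rkL; rewrite leq_eqVlt => /orP [/eqP rkL|]; last first.
  rewrite ltnS => rkL; apply: expect_hit_translate => B dB.
  apply: le_trans (IH _ _ _ j) _; rewrite ?rank_translate //; first exact: avoidable_translate.
  apply: ler_pM; rewrite ?exprn_ge0 //; first by lra.
  by rewrite lerXn2r ?nnegrE ?sqrtr_ge0 //; apply: le_trans qq; rewrite le_max lexx.
have [A fA eAL] := row_base_ex rkL.
(* If [L] is invariant, a single hit puts the whole orbit of [v] in [L], against avoidability. *)
have [st|nst] := boolP [forall e : 'I_n * 'I_n, (L *m rho (elt2 e) <= L)%MS].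
  have stab g : \det g = 1 -> (L *m rho g <= L)%MS.
    apply: (stable_elt2 prho) => i j' ij.
    by have /forallP/(_ (i, j')) := st; rewrite /elt2 /= (negbTE ij).
  have [g dg vg] := pL.
  rewrite (@expect_ext K n S SSL _ _ (fun=> 0)).
    by rewrite expect_cst // mulr_ge0 // exprn_ge0 // sqrtr_ge0.
  move=> X dX; case hX: (hit L X) => //; case/negP: vg.
  have : (v *m rho X *m rho (invmx X *m g) <= L *m rho (invmx X *m g))%MS by apply: submxMr.
  rewrite rhoM -mulmxA [rho X *m _]mulmxA (rhoK prho dX) mul1mx => h.
  by apply: submx_trans h _; rewrite -rhoM; apply: stab; rewrite det_mulmx det_invmx1 // mul1r.
have nfix : exists2 g, \det g = 1 & plu A *m tens l.+1 (rho g) != plu A.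
  have [e he] := forallPn nst; exists (elt2 e); first exact: det_elt2.
  apply: contra he => /eqP; rewrite -pluM => /esym /(plu_inj fA) eA.
  by rewrite (eqmxMr (rho (elt2 e)) (eqmx_sym eAL)) -eA eAL.
pose LB B := L *m rho (invmx B).
(* Either the translates coincide, and so do their Pluecker lines, or their intersection has smaller
   rank and the induction hypothesis applies. *)
have pair B B' : \det B = 1 -> \det B' = 1 ->
   expect S (l * j) (fun Y => (hit L (Y *m B))%:R * (hit L (Y *m B'))%:R) <=
   (lnorm (plu A *m tens l.+1 (rho (invmx B))) == lnorm (plu A *m tens l.+1 (rho (invmx B'))))%:R
   + C * r ^+ j.
  move=> dB dB'.
  have -> : expect S (l * j) (fun Y => (hit L (Y *m B))%:R * (hit L (Y *m B'))%:R) =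
     expect S (l * j) (fun Y => (hit (LB B :&: LB B')%MS Y)%:R) :> K.
    apply: expect_ext => // Y dY; rewrite !hitM // /hit sub_capmx.
    by case: (_ <= _)%MS; rewrite ?mul1r ?mul0r.
  have [e|ne] := boolP (LB B == LB B')%MS.
    have -> : lnorm (plu A *m tens l.+1 (rho (invmx B))) =
        lnorm (plu A *m tens l.+1 (rho (invmx B'))).
      rewrite -!pluM.
      have fAB : row_free (A *m rho (invmx B)).
        by rewrite /row_free mxrankMfree ?(eqP fA) // row_free_unit rho_unit ?det_invmx1.
      have eAB : (A *m rho (invmx B) :=: A *m rho (invmx B'))%MS.
        apply: eqmx_trans (eqmxMr _ eAL) _; apply: eqmx_trans (eqmx_sym (eqmxMr _ eAL)).
        exact/eqmxP.
      by have [c c0 ->] := plu_eqmx fAB eAB; rewrite lnormZ.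
    rewrite eqxx; apply: le_trans (_ : 1 <= _); last by rewrite lerDl mulr_ge0 // exprn_ge0.
    rewrite -[leRHS](expect_cst (l * j) 1 S0); apply: expect_le => // Y _.
    by rewrite lern1 leq_b1.
  apply: le_trans (IH (LB B :&: LB B')%MS _ _ j) _; last by rewrite lerDr ler0n.
    rewrite -ltnS -rkL -(rank_translate L dB); apply: rank_ltmx; rewrite ltmxE capmxSl /=.
    apply: contra ne; rewrite sub_capmx => /andP [_ le].
    by rewrite le /= -(mxrank_leqif_sup le).2 !rank_translate.
  have [g dg hg] := avoidable_translate dB pL; exists g => //.
  by apply: contra hg; rewrite /hit sub_capmx => /andP [].
(* Jensen's inequality in the first [l * j] steps, then the inner square is unfolded into two
   independent continuations. *)
have main : expect S (l * j + j) (fun X => (hit L X)%:R) ^+ 2 <= r' ^+ j + C * r ^+ j.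
  rewrite expect_add //; apply: le_trans (expect_sqr SSL S0 _ _) _.
  have -> : expect S (l * j) (fun Y => expect S j (fun B => (hit L (Y *m B))%:R) ^+ 2) =
    expect S j (fun B => expect S j (fun B' =>
      expect S (l * j) (fun Y => (hit L (Y *m B))%:R * (hit L (Y *m B'))%:R))) :> K.
    rewrite (@expect_ext K n S SSL _ _ (fun Y => expect S j (fun B => expect S j (fun B' =>
      (hit L (Y *m B))%:R * (hit L (Y *m B'))%:R)))) => [|Y _]; last exact: expect_sqrE.
    by rewrite expect_swap; apply: expect_ext => // B _; exact: expect_swap.
  pose F X Y : K := (lnorm (plu A *m tens l.+1 (rho X)) == lnorm (plu A *m tens l.+1 (rho Y)))%:R.
  apply: le_trans (_ : expect S j (fun B => expect S j (fun B' => F (invmx B) (invmx B')))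
      + C * r ^+ j <= _).
    rewrite -[X in _ + X](expect_cst j _ S0) -expectD; apply: expect_le => // B dB.
    rewrite -[X in _ + X](expect_cst j _ S0) -expectD; apply: expect_le => // B' dB'.
    exact: pair.
  rewrite lerD2r (expect_inv Suniq SSL Ssym j (fun B => expect S j (fun B' => F B (invmx B')))).
  apply: le_trans (gap _ nfix j); rewrite le_eqVlt; apply/orP; left; apply/eqP.
  by apply: expect_ext => // B _; rewrite (expect_inv Suniq SSL Ssym j (F B)).
rewrite -(@ler_pXn2r _ 2) ?nnegrE //; last 2 first.
- by apply: expect_ge0 => // X _; rewrite ler0n.
- by rewrite mulr_ge0 // exprn_ge0 // sqrtr_ge0.
apply: le_trans main _.
rewrite exprMn -exprM mulnC exprM sqr_sqrtr //.
have le1 : r' ^+ j <= q ^+ j by rewrite lerXn2r ?nnegrE // le_max lexx orbT.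
have le2 : r ^+ j <= q ^+ j by rewrite lerXn2r ?nnegrE // le_max lexx.
have := ler_wpM2l C0 le2; have : 0 <= q ^+ j by rewrite exprn_ge0.
move: (q ^+ j) (r ^+ j) (r' ^+ j) le1 le2 => x y z zx yx x0 h.
by nra.
Qed.

Lemma bernoulli (x : K) (k : nat) : 0 <= x <= 1 -> 1 - k%:R * x <= (1 - x) ^+ k.
Proof.
move=> /andP [x0 x1]; elim: k => [|k IH]; first by rewrite mul0r subr0.
have : (1 - x) * (1 - k%:R * x) <= (1 - x) * (1 - x) ^+ k by rewrite ler_wpM2l // subr_ge0.
rewrite exprS -natr1; have : 0 <= k%:R :> K by rewrite ler0n.
move: (k%:R) ((1 - x) ^+ k) => y z y0 h; have : 0 <= y * (x * x) by rewrite !mulr_ge0.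
by nra.
Qed.

Lemma hit_decay : exists C r : K, [/\ 0 <= C, 0 <= r, r < 1 &
  forall L : 'M[rat]_m, avoidable L ->
  forall k, expect S k (fun X => (hit L X)%:R) <= C * r ^+ k].
Proof.
have [C [r' [C0 r'0 r'1 dec]]] := hit_decay_rank m.
have [m0|m_gt0] := posnP m.
  exists 0, 0; split=> // L [g _]; rewrite /hit.
  have -> : v = 0 by apply/rowP=> i; have := ltn_ord i; rewrite {2}m0.
  by rewrite mul0mx sub0mx.
pose r := Num.max r' 2^-1.
have r0 : 0 < r by rewrite lt_max invr_gt0 ltr0n orbT.
have r1 : r < 1 by rewrite gt_max r'1 /=; lra.
have mR : 1 <= m%:R :> K by rewrite ler1n.
(* A substitute for the [m]-th root of [r]: Bernoulli's inequality gives [r <= s ^+ m]. *)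
pose s := 1 - (1 - r) / m%:R.
have x01 : 0 < (1 - r) / m%:R <= 1 - r.
  rewrite divr_gt0 ?subr_gt0 ?ltr0n //= ler_pdivrMr ?ltr0n //.
  by rewrite ler_peMr // subr_ge0 ltW.
have s01 : 0 < s < 1 by rewrite /s; lra.
have rs : r <= s ^+ m.
  have := @bernoulli ((1 - r) / m%:R) m; rewrite mulrCA divff ?gt_eqF ?ltr0n // mulr1.
  by rewrite subKr; apply; lra.
(* The factor [1 / r] absorbs the fewer than [m] steps left over by the division of [k] by [m]. *)
exists (C / r), s; split; rewrite ?divr_ge0 //; [exact: ltW | lra | lra |].
move=> L pL k.
rewrite {1}(divn_eq k m) mulnC.
apply: expect_hit_translate => B dB.
apply: le_trans (dec (L *m rho (invmx B)) (rank_leq_row _)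
  (avoidable_translate dB pL) (k %/ m)%N) _.
rewrite -mulrA ler_wpM2l //.
apply: le_trans (_ : r ^+ (k %/ m) <= _).
  by rewrite lerXn2r ?nnegrE // ?(ltW r0) // le_max lexx.
apply: le_trans (_ : s ^+ (m * (k %/ m)) <= _).
  by rewrite exprM lerXn2r ?nnegrE ?exprn_ge0 ?(ltW r0) //; lra.
rewrite ler_pdivlMl //; apply: le_trans (_ : s ^+ m * s ^+ (m * (k %/ m)) <= _).
  by rewrite ler_wpM2r // exprn_ge0; lra.
rewrite -exprD; apply: ler_wiXn2l; [lra | lra |].
by rewrite {1}(divn_eq k m) mulnC addnC leq_add2r ltnW // ltn_mod.
Qed.

End HitDecay.

(** Since [rho X - c = A *m sigma X *m D], multiplicativity of Pluecker coordinates makes the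
    determinant a linear form in [plu A *m tens m (sigma X)]; its vanishing is a [hit] of the kernel
    of that form. *)
Lemma det_decay (K : rcfType) (n : nat) (S : seq 'M[int]_n) :
  uniq S -> (forall s, s \in S -> \det s = 1) ->
  (forall s, s \in S -> invmx s \in S) ->
  generates_SL S ->
  (0 < size S)%N ->
  forall (m : nat) (rho : 'M[int]_n -> 'M[rat]_m) (c : rat), polyrep rho ->
  (exists2 g, \det g = 1 & \det (rho g - c%:M) != 0) ->
  exists C r : K, [/\ 0 <= C, 0 <= r, r < 1 &
    forall k, expect S k (fun X => (\det (rho X - c%:M) == 0)%:R) <= C * r ^+ k].
Proof.
move=> Suniq SSL Ssym Sgen S0 m rho c prho [g dg gn0].
pose sigma X := block_mx (rho X) 0 0 (1%:M : 'M[_]_m).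
have psig : polyrep (fun X => tens m (sigma X)) by apply/polyrep_tens/polyrep_add1.
pose A : 'M[rat]_(m, m + m) := row_mx 1%:M 1%:M.
pose D : 'M[rat]_(m + m, m) := col_mx 1%:M (- c%:M).
pose o := enum_rank [ffun i : 'I_m => i].
pose y := col o (tens m D).
have detE X : (\det (rho X - c%:M) == 0) =
    hit (fun X => tens m (sigma X)) (plu A) (kermx y) X.
  have -> : rho X - c%:M = A *m sigma X *m D.
    by rewrite mul_row_block mul_row_col !mul1mx addr0 add0r mulmx1 mul1mx.
  rewrite /hit -plu_det !pluM -/o sub_kermx.
  move: (plu A *m _) => u.
  have -> : u *m y = ((u *m tens m D) 0 o)%:M.
    apply/matrixP=> i j; rewrite !ord1 !mxE mulr1n; apply: eq_bigr => k _.
    by rewrite !mxE.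
  apply/eqP/eqP => [->|/matrixP/(_ 0 0)]; first by rewrite raddf0.
  by rewrite [LHS]mxE mulr1n [RHS]mxE.
have [C [r [C0 r0 r1 dec]]] := @hit_decay K n S Suniq SSL Ssym Sgen S0 _ _ (plu A) psig.
exists C, r; split=> // k.
rewrite (@expect_ext K n S SSL _ _
  (fun X => (hit (fun X => tens m (sigma X)) (plu A) (kermx y) X)%:R)).
  by apply: dec; exists g; rewrite // -detE.
by move=> X _; rewrite detE.
Qed.

(** * Reducible characteristic polynomials *)

Lemma intr_ratr (F : numFieldType) n (X : 'M[int]_n) :
  map_mx (ratr : rat -> F) (map_mx intr X) = map_mx intr X.
Proof. by apply/matrixP=> i j; rewrite !mxE ratr_int. Qed.

(** The tensor product of eigenvectors is an eigenvector for the product of the eigenvalues. *)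
Lemma tens_eigen (F : fieldType) n d (A : 'M[F]_n) (z : 'I_d -> F) :
  (forall k, eigenvalue A (z k)) -> \det (tens d A - (\prod_k z k)%:M) = 0.
Proof.
move=> ez.
have exv k : exists v : 'rV[F]_n, v *m A = z k *: v /\ v != 0.
  by have /eigenvalueP [v hv v0] := ez k; exists v.
have [v hv] := fin_all_exists exv.
apply/eqP/det0P.
exists (\row_J \prod_k v k 0 (fval J k)).
  have exi k : exists i, v k 0 i != 0 by apply/rV0Pn; case: (hv k).
  have [i hi] := fin_all_exists exi.
  apply/rV0Pn; exists (enum_rank (finfun i)); rewrite mxE /fval enum_rankK.
  by apply/prodf_neq0 => k _; rewrite ffunE.
rewrite mulmxBr mul_mx_scalar; apply/eqP; rewrite subr_eq0; apply/eqP/rowP=> J.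
rewrite !mxE -big_split /=.
under eq_bigr do rewrite !mxE -big_split /=.
rewrite (sum_enum_val (fun K : {ffun _ -> _} => \prod_k (v k 0 (K k) * A (K k) (fval J k)))).
rewrite -(bigA_distr_bigA (fun k i => v k 0 i * A i (fval J k))) /=.
by apply: eq_bigr => k _; have [/rowP/(_ (fval J k)) + _] := hv k; rewrite !mxE.
Qed.

Lemma int_unit (a : int) : a \is a GRing.unit -> a = 1 \/ a = -1.
Proof. by rewrite qualifE /= /intUnitRing.unitz => /orP [] /eqP ->; [left | right]. Qed.

Lemma reducible_tens n (X : 'M[int]_n) : \det X = 1 -> reducible_poly (charpoly_det X) ->
  exists d (c : rat), [/\ (0 < d < n)%N, c = 1 \/ c = -1 &
    \det (tens d (map_mx intr X) - c%:M) = 0].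
Proof.
move=> dX [p0 [_ [q [r [qu [ru pqr]]]]]].
have pE : charpoly_det X = (-1) ^+ n *: char_poly X.
  rewrite /charpoly_det /char_poly /char_poly_mx -opprB -scaleN1r detZ.
  by rewrite -[RHS]mul_polyC rmorphXn rmorphN1.
have sn : (-1) ^+ n \is a @GRing.unit int by rewrite unitrX // unitrN1.
have sn0 : (-1) ^+ n != 0 :> int by rewrite signr_eq0.
have sp : size (charpoly_det X) = n.+1 by rewrite pE size_scale // size_char_poly.
have lp : lead_coef (charpoly_det X) = (-1) ^+ n.
  by rewrite pE lead_coefZ (monicP (char_poly_monic X)) mulr1.
have cp : (charpoly_det X)`_0 = 1.
  by rewrite pE coefZ char_poly_det dX mulr1 -expr2 sqrr_sign.
have [lq lr] : lead_coef q \is a GRing.unit /\ lead_coef r \is a GRing.unit.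
  by apply/andP; rewrite -unitrM -lead_coefM -pqr lp.
have q0u : q`_0 \is a GRing.unit.
  have := coef0M q r; rewrite -pqr cp => e.
  by apply/unitrPr; exists r`_0.
(* Unit leading coefficients exclude non-unit constants as factors, so both factors have positive
   degree. *)
have big (s : {poly int}) : s \isn't a GRing.unit -> lead_coef s \is a GRing.unit -> (1 < size s)%N.
  move=> su ls; rewrite ltnNge; apply: contra su => ss.
  have [a e] : exists a, s = a%:P by exists s`_0; apply: size1_polyC.
  move: ls; rewrite {}e lead_coefC poly_unitE size_polyC coefC /= => ua.
  have a0 : a != 0 by apply: contraTneq ua => ->; rewrite unitr0.
  by rewrite ua a0.
have sq := big q qu lq; have sr := big r ru lr.
have q_neq0 : q != 0 by rewrite -size_poly_gt0 ltnW.
have r_neq0 : r != 0 by rewrite -size_poly_gt0 ltnW.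
have ssum : (size q + size r = n.+2)%N.
  have := size_mul q_neq0 r_neq0; rewrite -pqr sp => ->.
  by rewrite prednK // addn_gt0 (ltnW sq).
pose Q := map_poly intr q : {poly algC}.
have [s eQ] := closed_field_poly_normal Q.
have lQ : lead_coef Q = (lead_coef q)%:~R.
  by rewrite lead_coef_map_inj // => // ? ? /intr_inj.
have lQ0 : lead_coef Q != 0 by rewrite lQ intr_eq0 lead_coef_eq0.
have ss : size s = (size q).-1.
  have : size Q = size q by rewrite size_map_inj_poly // => ? ? /intr_inj.
  by rewrite eQ size_scale // size_prod_XsubC => <-.
have prodE : \prod_(z <- s) z = 1 \/ \prod_(z <- s) z = -1 :> algC.
  have : Q.[0] = (q`_0)%:~R by rewrite horner_coef0 coef_map.
  rewrite {1}eQ hornerZ horner_prod lQ.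
  have -> : \prod_(z <- s) ('X - z%:P).[0] = (-1) ^+ size s * \prod_(z <- s) z.
    under eq_bigr do rewrite hornerXsubC sub0r -mulN1r.
    by rewrite big_split /= big_const_seq count_predT iter_mulr mulr1.
  have sq1 (a : int) : a \is a GRing.unit -> (a%:~R : algC) ^+ 2 = 1.
    by case/int_unit => ->; rewrite ?rmorphN rmorph1 ?sqrrN expr1n.
  move/(congr1 (fun z => z ^+ 2)); rewrite !exprMn sqrr_sign !sq1 // !mul1r => /eqP.
  by rewrite sqrf_eq1 => /orP [] /eqP; [left | right].
pose d := size s.
pose XC := map_mx intr X : 'M[algC]_n.
have ev (k : 'I_d) : eigenvalue XC (nth 0 s k).
  rewrite eigenvalue_root_char.
  have -> : char_poly XC = map_poly intr (char_poly X) by rewrite -map_char_poly.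
  have zs : nth 0 s k \in s by apply: mem_nth.
  have : root Q (nth 0 s k).
    by rewrite eQ rootZ // root_prod_XsubC.
  move=> rQ.
  have : root (map_poly intr (charpoly_det X)) (nth 0 s k).
    by rewrite pqr rmorphM rootM -/Q rQ.
  by rewrite pE map_polyZ /= rootZ // intr_eq0.
have := tens_eigen ev.
have -> : \prod_(k < d) nth 0 s k = \prod_(z <- s) z by rewrite (big_nth 0) big_mkord.
have fin (c : rat) : \prod_(z <- s) z = ratr c -> \det (tens d XC - (\prod_(z <- s) z)%:M) = 0 ->
    \det (tens d (map_mx intr X) - c%:M) = 0.
  move=> -> h; apply/eqP; rewrite -(fmorph_eq0 (ratr : {rmorphism rat -> algC})) -det_map_mx.
  by rewrite map_mxB map_scalar_mx /= -tens_map intr_ratr h.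
have dn : (0 < d < n)%N by rewrite /d ss; lia.
case: prodE => e h.
  by exists d, 1; split=> //; [left | apply: fin; rewrite ?rmorph1].
by exists d, (-1); split=> //; [right | apply: fin; rewrite ?rmorphN1].
Qed.

(** * Non-vanishing of the determinants at some matrix of SL(n,Z) *)

Section Witness.
Variables (m : nat) (x y : int).

(* Upper triangular with diagonal [2, ..., 2, y] modulo any divisor of the corner entry [x]. *)
Definition bidiag : 'M[int]_m.+1 := \matrix_(i, j)
  if i == j then (if i == ord_max then y else 2)
  else if (j == i.+1 :> nat) then 1
  else if (i == ord_max) && (j == ord0) then x else 0.

Lemma det_bidiag : (0 < m)%N -> \det bidiag = (-1) ^+ m * x + 2 ^+ m * y.
Proof.
move=> m0; have max0 : (ord0 : 'I_m.+1) != ord_max by rewrite -(inj_eq val_inj) /= eq_sym -lt0n.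
rewrite (expand_det_row _ ord_max) (bigD1 ord0) //= (bigD1 ord_max) 1?eq_sym //=.
rewrite [X in _ + (_ + X)]big1 ?addr0 => [|j /andP [j0 jm]]; last first.
  rewrite mxE eq_sym (negbTE jm) (negbTE j0) andbF /=.
  by rewrite ifF ?mul0r //; apply/negbTE; have := ltn_ord j; lia.
have Lm (i : 'I_m) : lift ord_max i = i :> nat by apply: lift_max.
have oE (i j : 'I_m.+1) : (i == j) = (nat_of_ord i == nat_of_ord j) by [].
have L0 (i : 'I_m) : lift ord0 i = i.+1 :> nat by [].
congr (_ + _).
  rewrite mxE eq_sym (negbTE max0) /= !eqxx mulrC; congr (_ * _).
  rewrite /cofactor addn0 det_trig.
    rewrite big1 ?mulr1 //= => i _; rewrite !mxE !oE Lm L0.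
    by rewrite ifF ?eqxx //; lia.
  apply/is_trig_mxP=> /= i j ij; rewrite !mxE !oE Lm L0 /=.
  have jm : (j < m)%N := ltn_ord j; have im : (i < m)%N := ltn_ord i.
by rewrite !ifF //; lia.
rewrite mxE !eqxx mulrC; congr (_ * _).
rewrite /cofactor /= addnn -signr_odd odd_double expr0 mul1r -det_tr det_trig.
  rewrite (eq_bigr (fun=> 2)) ?prodr_const ?card_ord //= => i _.
  rewrite !mxE eqxx oE Lm /= ifF //.
  by have im : (i < m)%N := ltn_ord i; lia.
apply/is_trig_mxP=> /= i j ij; rewrite !mxE !oE !Lm /=.
have jm : (j < m)%N := ltn_ord j; have im : (i < m)%N := ltn_ord i.
by rewrite !ifF //; lia.
Qed.

End Witness.

(** The tensor power is triangular for the weight, the sum of the indices. At an index of least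
    weight in the support of a null vector, only the diagonal term survives, so [c] would be a
    diagonal product. *)
Lemma tens_upper_det (F : fieldType) n d (A : 'M[F]_n) (c : F) :
  (forall i j : 'I_n, (j < i)%N -> A i j = 0) ->
  (forall J : {ffun 'I_d -> 'I_n}, \prod_k A (J k) (J k) != c) ->
  \det (tens d A - c%:M) != 0.
Proof.
move=> up diag; apply/negP => /det0P [v /rV0Pn [J0 vJ0]].
rewrite mulmxBr mul_mx_scalar => /eqP; rewrite subr_eq0 => /eqP vA.
pose wt (J : 'I_(ndim d n)) := (\sum_k fval J k)%N.
case: (@arg_minnP _ J0 (fun J => v 0 J != 0) wt vJ0) => J vJ minJ.
have /rowP/(_ J) := vA; rewrite !mxE (bigD1 J) //= big1 ?addr0 => [|K KJ].
  rewrite mxE mulrC => /(mulIf vJ) e; have := diag (fval J).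
  by rewrite e eqxx.
have [vK|vK] := eqVneq (v 0 K) 0; first by rewrite vK mul0r.
rewrite mxE.
have [k kK|none] := pickP (fun k => (fval J k < fval K k)%N).
  by rewrite (bigD1 k) //= up // mul0r mulr0.
have le k : (fval K k <= fval J k)%N by rewrite leqNgt none.
have wle := minJ K vK.
case/eqP: KJ; apply: enum_val_inj; apply/ffunP=> k; apply: val_inj.
apply/eqP; rewrite -[enum_val K]/(fval K) -[enum_val J]/(fval J) eqn_leq le /= leqNgt.
apply: contraL wle => lt; rewrite -ltnNge /wt.
by rewrite (bigD1 k) //= [X in (_ < X)%N](bigD1 k) //= -addSn leq_add // leq_sum.
Qed.

(** Modulo a large prime [p] the witness is upper triangular with diagonal [2, ..., 2, 2^-m]. A
    product of [d] diagonal entries equal to [c] would mean that [2^(d-a)] is plus or minus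
    [2^(m a)] modulo [p], where [a] counts the last entry. *)
Lemma tens_nonvanishing n d (c : rat) : (0 < d < n)%N -> c = 1 \/ c = -1 ->
  exists2 g : 'M[int]_n, \det g = 1 & \det (tens d (map_mx intr g) - c%:M) != 0.
Proof.
case: n => [|m]; first by rewrite ltn0 andbF.
move=> dn c1; have m0 : (0 < m)%N by lia.
(* The bound exceeds the sum of the two powers of 2 to be compared, so congruence modulo [p] decides
   equality. *)
have [p pbig pp] := prime_above (2 ^ m.+1 + 2 ^ (m.+1 * m.+1)).
have p2 : (2 < p)%N.
  apply: leq_ltn_trans pbig; apply: leq_trans (leq_addr _ _).
  by rewrite expnS -[X in (X <= _)%N]muln1 leq_mul2l expn_gt0.
have Fp_nat (k : nat) : (k < p)%N -> (0 < k)%N -> (k%:R : 'F_p) != 0.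
  move=> kp k0; apply/eqP=> /(congr1 val) /=; rewrite val_Fp_nat // modn_small //.
  by move=> e; rewrite e in k0.
pose yF : 'F_p := (2 ^+ m)^-1.
pose y : int := (val yF)%:Z.
(* Forced by determinant 1 in [det_bidiag]; it vanishes modulo [p] because [y] lifts the inverse of
   [2^m]. *)
pose x : int := (-1) ^+ m * (1 - 2 ^+ m * y).
have two0 : (2 : 'F_p) != 0 by apply: Fp_nat.
have yE : (y%:~R : 'F_p) = (2 ^+ m)^-1 by rewrite /y -pmulrn natr_Zp.
have xE : (x%:~R : 'F_p) = 0.
  have t2 : ((2 ^+ m : int)%:~R : 'F_p) = 2 ^+ m by rewrite rmorphXn /= rmorph_nat.
  by rewrite /x intrM intrB intrM t2 yE mulfV ?expf_neq0 // subrr mulr0.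
exists (bidiag m x y).
  by rewrite det_bidiag // /x mulrA -expr2 sqrr_sign mul1r subrK.
have [ci cE ci1] : exists2 ci : int, c = ci%:~R & ci = 1 \/ ci = -1.
  by case: c1 => ->; [exists 1; [|left] | exists (-1); [|right]].
have -> : tens d (map_mx intr (bidiag m x y)) - c%:M =
    map_mx (intr : int -> rat) (tens d (bidiag m x y) - ci%:M).
  by rewrite map_mxB map_scalar_mx -tens_map cE.
rewrite det_map_mx intr_eq0.
suff : ((\det (tens d (bidiag m x y) - ci%:M))%:~R : 'F_p) != 0.
  by apply: contraNneq => ->.
rewrite -(det_map_mx (intr : int -> 'F_p)) map_mxB map_scalar_mx -tens_map.
apply: tens_upper_det => [i j ji|J].
  rewrite !mxE.
  have -> : (i == j) = false by apply/negbTE/eqP=> e; rewrite e ltnn in ji.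
  have -> : (j == i.+1 :> nat) = false by lia.
  by case: ifP.
pose a := #|[pred k | J k == ord_max]|.
have ad : (a <= d)%N by rewrite -[d]card_ord max_card.
have prodE : \prod_k (map_mx intr (bidiag m x y) (J k) (J k) : 'F_p) * 2 ^+ (m * a) = 2 ^+ (d - a).
  have -> : 2 ^+ (m * a) = \prod_k (if J k == ord_max then 2 ^+ m else 1) :> 'F_p.
    by rewrite -big_mkcond prodr_const exprM.
  have -> : 2 ^+ (d - a) = \prod_k (if J k != ord_max then 2 else 1) :> 'F_p.
    rewrite -big_mkcond prodr_const; congr (_ ^+ _).
    by rewrite -[d in LHS]card_ord -(cardC [pred k | J k == ord_max]) addKn; apply: eq_card.
  rewrite -big_split /=; apply: eq_bigr => k _; rewrite !mxE eqxx.
  case: eqP => _ /=; first by rewrite yE mulVf // expf_neq0.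
  by rewrite mulr1.
apply/eqP=> e; move: prodE; rewrite e => {}e.
have u_lt : (2 ^ (d - a) + 2 ^ (m * a) < p)%N.
  apply: leq_ltn_trans pbig; apply: leq_add; rewrite leq_exp2l //; first by lia.
  by apply: leq_mul => //; lia.
(* Equality would give [d = (m + 1) a], impossible for [0 < d < m + 1]. *)
have ne : (d - a != m * a)%N.
  apply/eqP=> h; have : (d = m.+1 * a)%N by lia.
  by case: (a) => [|a'] h'; lia.
have e' : (ci%:~R : 'F_p) * (2 ^ (m * a))%N%:R = (2 ^ (d - a))%N%:R by rewrite !natrX.
case: ci1 e' => ->; rewrite ?rmorphN rmorph1 ?mulN1r ?mul1r => e'.
  have := congr1 val e'; rewrite /= !val_Fp_nat // !modn_small; [|by lia|by lia].
  by move/eqP; rewrite eqn_exp2l // eq_sym (negbTE ne).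
have : ((2 ^ (d - a) + 2 ^ (m * a))%N%:R : 'F_p) != 0.
  by apply: Fp_nat; rewrite // addn_gt0 expn_gt0.
by rewrite natrD -e' addNr eqxx.
Qed.

(** * The law of the walk *)

Local Open Scope classical_set_scope.

Section WalkLaw.
Variables (n : nat) (S : seq 'M[int]_n) (d : measure_display)
  (Omega : measurableType d) (R : realType)
  (P : probability Omega R) (xi : nat -> Omega -> 'M[int]_n).
Hypotheses (hval : forall k w, xi k w \in S)
  (hmeas : forall k s, measurable (xi k @^-1` [set s]))
  (hunif : forall k s, s \in S -> P (xi k @^-1` [set s]) = ((size S)%:R^-1)%:E)
  (hind : mutually_independent P xi).

Fixpoint steps (k : nat) : seq (seq 'M[int]_n) :=
  if k is k'.+1 then [seq rcons s a | a <- S, s <- steps k'] else [:: [::]].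

Definition prods (s : seq 'M[int]_n) : 'M[int]_n := foldl (fun a b => a *m b) 1%:M s.

Lemma mem_steps k s : (s \in steps k) = (size s == k) && all (mem S) s.
Proof.
elim: k s => [|k IH] s /=; first by rewrite inE; case: s.
apply/allpairsP/idP => [[[a t] /= [aS tk ->]]|].
  by rewrite size_rcons all_rcons /= aS; move: tk; rewrite IH => /andP [/eqP -> ->]; rewrite eqxx.
case/lastP: s => [//|s a]; rewrite size_rcons all_rcons eqSS => /andP [sk /andP [aS sS]].
by exists (a, s); rewrite IH sk sS.
Qed.

Lemma expect_steps k (phi : 'M[int]_n -> R) :
  expect S k phi = (size S)%:R ^- k * \sum_(s <- steps k) phi (prods s).
Proof.
elim: k phi => [|k IH] phi /=; first by rewrite big_seq1 expr0 invr1 mul1r.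
rewrite big_allpairs_dep /= exprS invfM -mulrA; congr (_ * _).
rewrite mulr_sumr; apply: eq_bigr => a _; rewrite IH; congr (_ * _).
by apply: eq_bigr => s _; rewrite /prods foldl_rcons.
Qed.

Definition cyl (k : nat) (s : seq 'M[int]_n) : set Omega :=
  \big[setI/setT]_(i <- iota 0 k) (xi i @^-1` [set nth 0 s i]).

Lemma measurable_cyl k s : measurable (cyl k s).
Proof. by apply: bigsetI_measurable => i _; apply: hmeas. Qed.

Lemma prob_cyl k s : s \in steps k -> P (cyl k s) = ((size S)%:R ^- k)%:E.
Proof.
rewrite mem_steps => /andP [/eqP sk sS].
rewrite /cyl (hind (fun i => [set nth 0 s i]) (iota_uniq 0 k)).
rewrite (eq_big_seq (fun=> ((size S)%:R^-1)%:E)); last first.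
  move=> i; rewrite mem_iota /= add0n => ik; apply: hunif.
  by apply: (allP sS); apply: mem_nth; rewrite sk.
by rewrite prodEFin big_const_seq count_predT size_iota iter_mulr mulr1 exprVn.
Qed.

Lemma walkE k w : walk xi k w = prods [seq xi i w | i <- iota 0 k].
Proof.
rewrite /walk /prods; move: (1%:M) (iota 0 k) => x s.
by elim: s x => [//|i s IH] x /=; rewrite IH.
Qed.

(** A finite union of cylinders, hence measurable, that contains the event that the walk satisfies
    [A] at time [k]. *)
Definition hits (A : pred 'M[int]_n) k : set Omega :=
  \big[setU/set0]_(s <- steps k | A (prods s)) cyl k s.

Lemma measurable_hits A k : measurable (hits A k).
Proof. by apply: bigsetU_measurable => s _; apply: measurable_cyl. Qed.

Lemma walk_hits (A : pred 'M[int]_n) k w : A (walk xi k w) -> hits A k w.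
Proof.
rewrite walkE => Aw; rewrite /hits -bigcup_seq_cond /=.
exists [seq xi i w | i <- iota 0 k].
  rewrite /= Aw andbT mem_steps size_map size_iota eqxx /=.
  by apply/allP=> _ /mapP [i _ ->]; apply: hval.
rewrite /cyl -bigcap_seq => i /= ik.
rewrite (nth_map 0%N) ?size_iota; last by move: ik; rewrite mem_iota.
by rewrite nth_iota // ; move: ik; rewrite mem_iota.
Qed.

Lemma prob_hits (A : pred 'M[int]_n) k :
  (P (hits A k) <= (expect S k (fun X => (A X)%:R))%:E)%E.
Proof.
rewrite expect_steps mulr_sumr -sumEFin /hits.
have : {subset steps k <= steps k} by [].
elim: {1 3 4}(steps k) => [_|s r IH sub]; first by rewrite !big_nil measure0.
rewrite !big_cons; have {}IH := IH (fun x xr => sub x (mem_behead (s := s :: r) xr)).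
have mr : measurable (\big[setU/set0]_(j <- r | A (prods j)) cyl k j).
  by apply: bigsetU_measurable => j _; apply: measurable_cyl.
case: ifP => As; last by rewrite mulr0 add0e.
apply: le_trans (measureU2 _ (measurable_cyl k s) mr) _.
apply: leeD; last exact: IH.
rewrite mulr1 -(prob_cyl (sub s (mem_head _ _))).
exact: lexx.
Qed.

(** Borel-Cantelli: the probabilities are dominated by a convergent geometric series. *)
Lemma ae_finite (A : pred 'M[int]_n) (C r : R) : 0 <= C -> 0 <= r -> r < 1 ->
  (forall k, expect S k (fun X => (A X)%:R) <= C * r ^+ k) ->
  {ae P, forall w, finite_set [set k | A (walk xi k w)]}.
Proof.
move=> C0 r0 r1 dec.
have pF k : (P (hits A k) <= (C * r ^+ k)%:E)%E.
  by apply: le_trans (prob_hits A k) _; rewrite lee_fin.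
have null : P (lim_sup_set (hits A)) = 0.
  apply: lim_sup_set_cvg0; first exact: measurable_hits.
  apply: le_lt_trans (ltry (C / (1 - r))).
  apply: lime_le; first exact: is_cvg_nneseries.
  apply: nearW => N; apply: le_trans (_ : (\sum_(0 <= k < N) (C * r ^+ k)%:E <= _)%E).
    by apply: lee_sum => k _; apply: pF.
  rewrite sumEFin lee_fin -[leLHS]/(series (geometric C r) N) geometric_seriesE ?lt_eqF //=.
  rewrite ler_pM2r ?invr_gt0 ?subr_gt0 // ler_piMr //.
  by rewrite lerBlDr lerDl exprn_ge0.
exists (lim_sup_set (hits A)); split=> //.
  apply: bigcapT_measurable => k; apply: bigcup_measurable => j _.
  exact: measurable_hits.
move=> w /= inf N _.
have [[k Nk Ak]|none] := pselect (exists2 k, (N <= k)%N & A (walk xi k w)).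
  by exists k => //; apply: walk_hits.
case: inf; apply: sub_finite_set (finite_II N) => k /= Ak.
by rewrite ltnNge; apply/negP=> Nk; apply: none; exists k.
Qed.

End WalkLaw.

(** * Almost sure irreducibility at all large times *)

Theorem theorem1p2 (n : nat) (hn : (2 <= n)%N)
  (S : seq 'M[int]_n) (hSuniq : uniq S)
  (hSSL : forall s, s \in S -> \det s = 1)
  (hSsym : forall s, s \in S -> invmx s \in S)
  (hSgen : generates_SL S)
  (d : measure_display) (Omega : measurableType d) (R : realType)
  (P : probability Omega R) (xi : nat -> Omega -> 'M[int]_n)
  (hval : forall k w, xi k w \in S)
  (hmeas : forall k s, measurable (xi k @^-1` [set s]))
  (hunif : forall k s, s \in S ->
     P (xi k @^-1` [set s]) = ((size S)%:R^-1)%:E)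
  (hind : mutually_independent P xi) :
  {ae P, forall w, finite_set [set k | reducible_poly (charpoly_det (walk xi k w))]}.
Proof.
(* The empty set generates only the identity, while [elt 0 1 1] has determinant 1 and a non-zero
   entry off the diagonal. *)
have S0 : (0 < size S)%N.
  case: n hn S {hSuniq hSSL hSsym hunif hval hmeas hind xi} hSgen => [//|[//|m]] _ [|//] gen.
  have ne : (0 : 'I_m.+2) != 1 by [].
  have [[|a w] [//= _ e]] := gen _ (elementary_det (elementary_elt 1 ne)).
  by have /matrixP/(_ 0 1) := e; rewrite !mxE.
pose bad k c (X : 'M[int]_n) := \det (tens k (map_mx intr X) - c%:M) == 0 :> rat.
have ae_bad k c : (0 < k < n)%N -> c = 1 \/ c = -1 ->
    {ae P, forall w, finite_set [set j | bad k c (walk xi j w)]}.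
  move=> kn c1; have [g dg gn] := tens_nonvanishing kn c1.
  have [|C [r [C0 r0 r1 dec]]] := @det_decay R n S hSuniq hSSL hSsym hSgen S0 _ _ c
      (polyrep_tens k (polyrep_std n)); first by exists g.
  exact: ae_finite hval hmeas hunif hind _ _ _ C0 r0 r1 dec.
have : {ae P, forall w, forall k, (0 < k < n)%N ->
    finite_set [set j | bad k 1 (walk xi j w)] /\ finite_set [set j | bad k (-1) (walk xi j w)]}.
  apply: ae_foralln => k; have [kn|kn] := boolP (0 < k < n)%N; last first.
    by apply: aeW => w.
  have h1 := ae_bad k 1 kn (or_introl erefl); have h2 := ae_bad k (-1) kn (or_intror erefl).
  by apply: filterS2 h1 h2 => w f1 f2 _; split.
apply: filterS => w fin.
have detw k : \det (walk xi k w) = 1.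
  rewrite walkE /prods; elim/last_ind: (iota 0 k) => [|s i IH]; first by rewrite det1.
  by rewrite map_rcons foldl_rcons det_mulmx IH hSSL // mulr1.
(* The reducible times lie in the union over the finitely many degrees [0 < k < n] and both signs of
   the times when the determinant vanishes. *)
apply: (@sub_finite_set _ _ (\bigcup_(k in `I_n) [set j | (0 < k)%N &&
   (bad k 1 (walk xi j w) || bad k (-1) (walk xi j w))])).
  move=> j /= red; have [k [c [/andP [k0 kn] c1 e]]] := reducible_tens (detw j) red.
  exists k => //=; rewrite k0 /=.
  by case: c1 e => -> e; apply/orP; [left | right]; apply/eqP.
apply: bigcup_finite; first exact: finite_II.
move=> k /= kn; have [k0|k0] := posnP k.
  by apply: sub_finite_set (finite_set0 _) => j.
have [|f1 f2] := fin k; first by rewrite k0.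
apply: (@sub_finite_set _ _
  ([set j | bad k 1 (walk xi j w)] `|` [set j | bad k (-1) (walk xi j w)])).
  by move=> j /= /orP []; [left | right].
by rewrite finite_setU.
Qed.
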